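(* Let $r,q\in\mathbb{C}[z_1,z_2]$ have no common factors and satisfy $\deg r=(m,n)=\deg q$. Define the polynomials $$R(w)=(1-iw_1)^m(1-iw_2)^n\,r(\beta(w_1),\beta(w_2)),\qquad Q(w)=(1-iw_1)^m(1-iw_2)^n\,q(\beta(w_1),\beta(w_2)).$$ Then there is a rational inner function $\phi$ on $\mathbb{D}^2$ with $\deg\phi=(m,n)$ such that $\mathcal{L}_1(\phi)=\mathcal{Z}_r$ and $\mathcal{L}_{-1}(\phi)=\mathcal{Z}_q$ if and only if there is a nonzero constant $c$ such that $\Phi:=c\frac{R}{Q}$ is a rational inner Pick function on $\Pi^2$.
   Context: $\mathbb{D}$ is the open unit disk, $\mathbb{T}$ the unit circle, $\Pi$ the open upper half-plane, and $\beta(w)=\frac{1+iw}{1-iw}$, a conformal map of $\Pi$ onto $\mathbb{D}$. $\deg$ denotes bidegree: for a polynomial, the largest powers of $z_1$ and $z_2$ appearing; for a rational function in lowest terms, the coordinatewise maximum of the bidegrees of numerator and denominator. $\mathcal{Z}_r=\{z\in\mathbb{C}^2:r(z)=0\}$. A rational inner function (RIF) on $\mathbb{D}^2$ is a rational function that is holomorphic and bounded on $\mathbb{D}^2$ with $|\phi|=1$ a.e. on $\mathbb{T}^2$. For an RIF written in lowest terms as $\phi=f/g$ and $\lambda\in\mathbb{T}$, $\mathcal{L}_\lambda(\phi)=\{z\in\mathbb{C}^2:f(z)=\lambda g(z)\}$. A rational inner Pick function on $\Pi^2$ is a rational function $\Phi$ with no poles on $\Pi^2$, mapping $\Pi^2$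 into $\Pi$, with $\mathrm{Im}\,\Phi(x)=0$ for a.e. $x\in\mathbb{R}^2$.
   Formalization: The case (m,n)=(0,0) of constant r, q is excluded, since there the equivalence fails: for r=q=1, φ=i has L_1 and L_{-1} empty as required, but a constant Φ=c cannot map into Π and be real a.e. on R². *)

(* Defs.v *)
From HB Require Import structures.
From mathcomp Require Import all_boot all_order all_algebra.
From mathcomp Require Import polyXY fraction complex ring.
From mathcomp Require Import all_classical all_reals all_analysis.

Set Implicit Arguments.
Unset Strict Implicit.
Unset Printing Implicit Defensive.

Import Order.TTheory GRing.Theory Num.Theory.
Import numFieldNormedType.Exports.

Local Open Scope classical_set_scope.
Local Open Scope ring_scope.

(* C[z1, z2] is {poly {poly R[i]}}: the outer variable 'X is z1, the inner
   variable 'Y is z2, and p.[z1, z2] is the evaluation notation of polyXY.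
   The field of rational functions C(z1, z2) is its fraction field. *)
Notation poly2 R := {poly {poly R[i]}}.
Notation ratfun2 R := {fraction {poly {poly R[i]}}}.

Section Polynomials.
Variable R : realType.
Local Notation C := (R[i]).
Implicit Types (f g p r q : poly2 R) (z : C * C).

Definition eval2 p z : C := p.[z.1, z.2].

Definition zero_set p : set (C * C) := [set z | eval2 p z = 0].

Definition divides d p := exists u : poly2 R, p = d * u.

Definition no_common_factor p q :=
  forall d : poly2 R, divides d p -> divides d q -> d \is a GRing.unit.

(* size and sizeY are one more than the degrees in z1 and in z2. *)
Definition bideg p : nat * nat := ((size p).-1, (sizeY p).-1).

Definition lowest_terms (phi : ratfun2 R) f g :=
  [/\ g != 0, phi = tofrac f / tofrac g & no_common_factor f g].

(* The bidegree of the rational function f / g, for f / g in lowest terms. *)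
Definition bideg_frac f g : nat * nat :=
  (maxn (bideg f).1 (bideg g).1, maxn (bideg f).2 (bideg g).2).

Definition level_set f g (lambda : C) : set (C * C) :=
  [set z | eval2 f z = lambda * eval2 g z].

(* phi has no pole at z (some representation of phi has a denominator that
   does not vanish at z), and its value there is v. *)
Definition ratfun_value (phi : ratfun2 R) z (v : C) :=
  exists f g, [/\ phi = tofrac f / tofrac g, eval2 g z != 0 &
                  v = eval2 f z / eval2 g z].

End Polynomials.

Lemma cayley_subst (F : fieldType) (a x y : F) (m n : nat)
  (r : {poly {poly F}}) :
  ((size r).-1, (sizeY r).-1) = (m, n) -> 1 - a * x != 0 -> 1 - a * y != 0 ->
  (\sum_(j < m.+1) \sum_(k < n.+1)
    (r`_j`_k)%:P%:P * ((1 + a%:P%:P * 'X) ^+ j * (1 - a%:P%:P * 'X) ^+ (m - j))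
      * ((1 + a%:P%:P * 'Y) ^+ k * (1 - a%:P%:P * 'Y) ^+ (n - k))).[x, y] =
  (1 - a * x) ^+ m * (1 - a * y) ^+ n
  * r.[(1 + a * x) / (1 - a * x), (1 + a * y) / (1 - a * y)].
Proof.
move=> [dm dn] x0 y0.
have szr : (size r <= m.+1)%N by rewrite -dm leqSpred.
have szrj (j : nat) : (size (r`_j)%R <= n.+1)%N.
  have [jr|jr] := ltnP j (size r); last by rewrite nth_default // size_poly0.
  apply: (@leq_trans (sizeY r)); last by rewrite -dn leqSpred.
  exact: (leq_bigmax (Ordinal jr)).
rewrite (horner_coef_wide _ szr) !horner_sum mulr_sumr; apply: eq_bigr => j _.
rewrite hornerM (horner_coef_wide _ (szrj j)) !horner_sum mulr_suml mulr_sumr.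
apply: eq_bigr => k _.
rewrite !(hornerM, hornerD, hornerN, horner_exp, hornerC, hornerX).
have jm : (j <= m)%N by rewrite -ltnS.
have kn : (k <= n)%N by rewrite -ltnS.
have -> : (1 - a * x) ^+ m = (1 - a * x) ^+ (m - j) * (1 - a * x) ^+ j.
  by rewrite -exprD subnK.
have -> : (1 - a * y) ^+ n = (1 - a * y) ^+ (n - k) * (1 - a * y) ^+ k.
  by rewrite -exprD subnK.
rewrite !expr_div_n.
have e1 := expf_neq0 j x0; have e2 := expf_neq0 k y0.
move: (_ ^+ (m - j)) (_ ^+ (n - k)) e1 e2 => u v.
move: ((1 - _) ^+ j) ((1 - _) ^+ k) => s t s0 t0.
field.
by rewrite s0.
Qed.

Section InnerFunctions.
Variable R : realType.
Local Notation C := (R[i]).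

Definition imag_unit : C := ('i)%C.

Definition cayley (w : C) : C := (1 + imag_unit * w) / (1 - imag_unit * w).

Definition bidisk : set (C * C) := [set z | `|z.1| < 1 /\ `|z.2| < 1].

Definition upper_bihalfplane : set (C * C) :=
  [set w | 0 < complex.Im w.1 /\ 0 < complex.Im w.2].

(* Complex (Frechet) differentiability: the field of scalars is R[i]. *)
Definition holomorphic_on (D : set (C * C)) (h : C * C -> C) :=
  let K : numFieldType := R[i] in
  forall z : K * K, D z -> differentiable (h : K * K -> K) z.

Definition cis (t : R) : C := (cos t +i* sin t)%C.

Definition lebesgue2 := (@lebesgue_measure R \x @lebesgue_measure R)%E.

(* Almost everywhere for the product of the arc length measures. *)
Definition ae_on_torus (P : C * C -> Prop) :=
  {ae lebesgue2, forall t : R * R,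
    t.1 \in `[0, 2 * pi[ -> t.2 \in `[0, 2 * pi[ -> P (cis t.1, cis t.2)}.

Definition rational_inner (phi : ratfun2 R) :=
  (exists h : C * C -> C,
    [/\ holomorphic_on bidisk h,
        forall z v, bidisk z -> ratfun_value phi z v -> h z = v &
        exists M : C, forall z, bidisk z -> `|h z| <= M]) /\
  ae_on_torus (fun z => exists2 v, ratfun_value phi z v & `|v| = 1).

Definition rational_inner_pick (Phi : ratfun2 R) :=
  (forall w, upper_bihalfplane w ->
    exists2 v, ratfun_value Phi w v & 0 < complex.Im v) /\
  {ae lebesgue2, forall x : R * R,
    exists2 v, ratfun_value Phi (x.1%:C, x.2%:C)%C v & complex.Im v = 0}.

(* The polynomial (1 - i w1)^m (1 - i w2)^n r(cayley w1, cayley w2), with the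
   denominators cleared; see halfplane_polyE. *)
Definition halfplane_poly (m n : nat) (r : poly2 R) : poly2 R :=
  let iC : poly2 R := imag_unit%:P%:P in
  \sum_(j < m.+1) \sum_(k < n.+1)
    (r`_j`_k)%:P%:P * ((1 + iC * 'X) ^+ j * (1 - iC * 'X) ^+ (m - j))
                    * ((1 + iC * 'Y) ^+ k * (1 - iC * 'Y) ^+ (n - k)).

Lemma halfplane_polyE (m n : nat) (r : poly2 R) (w : C * C) :
  bideg r = (m, n) ->
  1 - imag_unit * w.1 != 0 -> 1 - imag_unit * w.2 != 0 ->
  eval2 (halfplane_poly m n r) w =
  (1 - imag_unit * w.1) ^+ m * (1 - imag_unit * w.2) ^+ n
  * eval2 r (cayley w.1, cayley w.2).
Proof. exact: cayley_subst. Qed.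

End InnerFunctions.

(* Main.v *)
Require Import Defs.
From HB Require Import structures.
From mathcomp Require Import all_boot all_order all_algebra.
From mathcomp Require Import polyXY separable fraction complex ring.
From mathcomp Require Import all_classical all_reals all_analysis.
From mathcomp Require Import measurable_realfun.

(* Given an inner [phi = f / g], boundedness and [|f| = |g|] on the torus force,
   on almost every slice [z1 = tau] of modulus one, [f(tau, -) / g(tau, -)] to be
   a finite Blaschke product of degree [n].  Its unimodular level sets consist of
   exactly [n] simple points, so a polynomial of bidegree [(m, n)] whose zero set
   is that of [f - l g] must be a constant multiple of [f - l g]: compare slices
   in both variables.  Hence [r / q] is a multiple of [(f - g) / (f + g)], a
   Moebius transform of [phi], and [-i (f - g) / (f + g)] has imaginary part
   [(|g|^2 - |f|^2) / |f + g|^2].  Conversely [f = q + i c r] and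
   [g = q - i c r] recover [phi] from [c R / Q].

   The inequality [|f| < |g|] on the bidisk comes from the one-variable
   statement on the analytic disks through a given point, and [g] has no zero
   there because common zeros of coprime polynomials lie over finitely many
   [z1], whereas the zeros of [g] are not isolated. *)

Set Implicit Arguments.
Unset Strict Implicit.
Unset Printing Implicit Defensive.

Import Order.TTheory GRing.Theory Num.Theory.
Import numFieldNormedType.Exports.

Local Open Scope classical_set_scope.
Local Open Scope ring_scope.

(** * Finite Blaschke products *)

Section OneVariable.
Variable C : numClosedFieldType.
Implicit Types (A B F G d p : {poly C}) (a x y z M : C).

(** The lemmas on one variable and on the bidisk hold over an abstract [numClosedFieldType], so
    limits, the maximum principle and Hurwitz's theorem are replaced by root counting and explicit
    estimates on polynomials. A hypothesis [d != 0] with a guard [d.[z] != 0] means: for all but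
    finitely many [z]. Such exceptions are natural, since [f] and [g] may have common zeros on the
    torus and a slice may lose coprimality or degree. The main obstacle is that level sets are
    compared as sets, without multiplicities; simplicity of the roots on slices is what recovers the
    polynomial. Almost everywhere hypotheses enter through conjugate reflection, which turns them
    into the vanishing of a polynomial almost everywhere, hence everywhere. *)

Lemma nonroot_of_injective d (s : nat -> C) :
  d != 0 -> injective s -> exists k : nat, d.[s k] != 0.
Proof.
move=> d0 si; pose rs := [seq s k | k <- iota 0 (size d)].
have [/allP ar|/allPn[x /mapP[k _ ->] nr]] := boolP (all (root d) rs).
  have := @max_poly_roots _ d rs d0.
  rewrite map_inj_uniq // iota_uniq size_map size_iota ltnn.
  by move=> h; have /h := introT allP ar => /(_ isT).
by exists k.
Qed.

Lemma cayley_norm1 (t : C) : t \is Num.real -> `|(1 + 'i * t) / (1 - 'i * t)| = 1.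
Proof.
move=> tr.
have e : (1 + 'i * t)^* = 1 - 'i * t.
  by rewrite rmorphD rmorph1 rmorphM /= conjCi (CrealP tr) mulNr.
have n0 : 1 - 'i * t != 0.
  apply/eqP => h; have : 'Re (1 - 'i * t) = 1.
    by rewrite raddfB /= ReM Re_i Im_i (Creal_ReP 1 _) ?rpred1 //
      (Creal_ImP t tr) ?mul0r ?mulr0 ?subr0 ?oppr0.
  by rewrite h raddf0 => /esym/eqP; rewrite oner_eq0.
by rewrite normf_div -e norm_conjC divff // normr_eq0 -conjC_eq0 e.
Qed.

(** Infinitely many points of the circle are available in any such field as Cayley images of the
    natural numbers; one of them is a root of neither [p] nor [d]. *)
Lemma circle_poly_eq0 p d : d != 0 ->
  (forall z, `|z| = 1 -> d.[z] != 0 -> p.[z] = 0) -> p = 0.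
Proof.
move=> d0 h; apply/eqP/negPn/negP => p0.
pose s (k : nat) : C := (1 + 'i * k%:R) / (1 - 'i * k%:R).
have n0 (k : nat) : 1 - 'i * k%:R != 0 :> C.
  have := cayley_norm1 (realn _ k); apply: contra_eq_neq => ->.
  by rewrite invr0 mulr0 normr0 eq_sym oner_neq0.
have si : injective s.
  move=> k l /eqP; rewrite eqr_div // -subr_eq0.
  have -> : (1 + 'i * k%:R) * (1 - 'i * l%:R) - (1 + 'i * l%:R) * (1 - 'i * k%:R)
    = ('i *+ 2) * (k%:R - l%:R) :> C by ring.
  by rewrite mulf_eq0 mulrn_eq0 /= (negPf (neq0Ci _)) /= subr_eq0 eqr_nat => /eqP.
have [k] := @nonroot_of_injective (p * d) s (mulf_neq0 p0 d0) si.
rewrite hornerM mulf_eq0 negb_or => /andP[pk dk].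
by rewrite (h _ (cayley_norm1 (realn _ k)) dk) eqxx in pk.
Qed.

(** Continuity in quantitative form. The radius 2 covers the difference of any two points of the
    closed unit disk. *)
Lemma poly_lipschitz p x : exists2 K, 0 < K &
  forall u, `|u| <= 2 -> `|p.[x + u] - p.[x]| <= K * `|u|.
Proof.
elim/poly_ind: p => [|p c [K K0 hK]].
  by exists 1 => // u _; rewrite !horner0 subrr normr0 mul1r.
exists (K * (`|x| + 2) + `|p.[x]|) => [|u hu].
  by rewrite ltr_wpDr // mulr_gt0 // ltr_wpDl.
rewrite !hornerMXaddC.
have -> : p.[x + u] * (x + u) + c - (p.[x] * x + c)
  = (p.[x + u] - p.[x]) * (x + u) + p.[x] * u by ring.
rewrite (le_trans (ler_normD _ _)) // !normrM mulrDl lerD2r mulrAC.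
rewrite ler_pM // ?hK // (le_trans (ler_normD _ _)) // lerD2l //.
Qed.

(* Approach [x] along the segment towards an interior point of the disk,
   avoiding the finitely many roots of [d]. *)
Lemma closed_disk_le A B d M : 0 <= M -> d != 0 ->
  (forall x, `|x| < 1 -> d.[x] != 0 -> `|A.[x]| <= M * `|B.[x]|) ->
  forall x, `|x| <= 1 -> `|A.[x]| <= M * `|B.[x]|.
Proof.
move=> M0 d0 h x x1; rewrite real_leNgt ?rpredM ?normr_real ?ger0_real //.
apply/negP; rewrite -subr_gt0; set e := _ - _ => e0.
have [y y1 yx] : exists2 y, `|y| < 1 & y != x.
  have [->|xn0] := eqVneq x 0; last by exists 0; rewrite ?normr0 // eq_sym.
  exists 2^-1; last by rewrite invr_eq0 pnatr_eq0.
  by rewrite ger0_norm ?invr_ge0 ?ler0n // invf_lt1 ?ltr0n // ltr1n.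
have [KA KA0 hA] := poly_lipschitz A x.
have [KB KB0 hB] := poly_lipschitz B x.
set v := y - x; have v0 : v != 0 by rewrite subr_eq0.
have nv : 0 < `|v| by rewrite normr_gt0.
pose K := (KA + M * KB) * `|v|.
have K0 : 0 < K by rewrite mulr_gt0 // ltr_pwDl // mulr_ge0 // ltW.
have eK : 0 < e + K by rewrite addr_gt0.
(* These steps are pairwise distinct, so one of them avoids the roots of [d]; they are below 1,
   which keeps the point inside the disk; and [K * t k < e], against the bound [e <= K * t k]
   obtained from the Lipschitz estimates. *)
pose t (k : nat) := e / (e + K) / k.+1%:R.
have k0 (k : nat) : 0 < k.+1%:R :> C by rewrite ltr0n.
have t0 k : 0 < t k by rewrite !divr_gt0.
have tlt k : t k < 1.
  rewrite /t -mulrA -invfM ltr_pdivrMr ?mulr_gt0 // mul1r.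
  apply: (@lt_le_trans _ _ (e + K)); first by rewrite ltrDl.
  by rewrite ler_peMr ?(ltW eK) // ler1n.
have tK k : K * t k < e.
  rewrite /t mulrA [X in X < _](_ : _ = (K * e) / ((e + K) * k.+1%:R)); last first.
    by rewrite invfM; ring.
  rewrite ltr_pdivrMr ?mulr_gt0 // mulrC ltr_pM2l //.
  apply: (@lt_le_trans _ _ (e + K)); first by rewrite ltrDr.
  by rewrite ler_peMr ?(ltW eK) // ler1n.
have sinj : injective (fun k => x + t k * v).
  move=> k l /addrI /(mulIf v0) /mulfI; rewrite mulf_neq0 ?gt_eqF ?invr_gt0 //.
  by move=> /(_ isT) /invr_inj /eqP; rewrite eqr_nat => /eqP [].
have [k dk] := nonroot_of_injective d0 sinj.
move: (t0 k) (tlt k) (tK k) dk; rewrite /=; move: (t k) =>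
  tk {t t0 tlt tK sinj k} t0 tlt tK dk.
have xt1 : `|x + tk * v| < 1.
  have -> : x + tk * v = (1 - tk) * x + tk * y by rewrite /v; ring.
  rewrite (le_lt_trans (ler_normD _ _)) // !normrM.
  rewrite (gtr0_norm t0) gtr0_norm ?subr_gt0 //.
  rewrite -[ltRHS](subrK (tk)) ler_ltD //.
    by rewrite ler_piMr // subr_ge0 ltW.
  by rewrite gtr_pMr.
have tv2 : `|tk * v| <= 2.
  rewrite normrM (gtr0_norm t0).
  rewrite -[leRHS]mul1r ler_pM ?(ltW t0) ?(ltW tlt) //.
  by rewrite (le_trans (ler_normB _ _)) // -[2]/(1 + 1) lerD // ltW.
have hx := h _ xt1 dk.
have a1 : `|A.[x]| <= `|A.[x + tk * v]| + KA * `|tk * v|.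
  rewrite -lerBlDl (le_trans _ (hA _ tv2)) // distrC lerB_dist //.
have b1 : M * `|B.[x + tk * v]| <= M * `|B.[x]| + M * (KB * `|tk * v|).
  rewrite -mulrDr ler_wpM2l // -lerBlDl (le_trans _ (hB _ tv2)) // lerB_dist //.
have : e <= K * tk.
  rewrite lerBlDl (le_trans a1) // (le_trans (lerD hx (lexx _))) //.
  rewrite (le_trans (lerD b1 (lexx _))) // -addrA lerD2l.
  rewrite normrM (gtr0_norm t0) /K le_eqVlt; apply/orP; left; apply/eqP; ring.
by move=> /le_lt_trans /(_ tK); rewrite ltxx.
Qed.

(** The reciprocal polynomial [z^m * conj (p (1 / conj z))], relative to a nominal degree [m] that
    may exceed the degree of [p]. *)
Definition reflect_poly (m : nat) p := \poly_(j < m.+1) (p`_(m - j))^*.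

Lemma horner_reflect m p z : (size p <= m.+1)%N -> z != 0 ->
  (reflect_poly m p).[z] = z ^+ m * (p.[(z^*)^-1])^*.
Proof.
move=> sp z0; rewrite horner_poly (horner_coef_wide _ sp) rmorph_sum mulr_sumr.
rewrite (reindex_inj rev_ord_inj) /=; apply: eq_bigr => j _.
have jm : (j <= m)%N by rewrite -ltnS.
rewrite subSS subKn // rmorphM rmorphXn /= fmorphV /= conjCK mulrCA exprVn.
by congr (_ * _); rewrite -expfB_cond ?z0 // (negPf z0) add0n.
Qed.

Lemma horner_reflect_circle m p z : (size p <= m.+1)%N -> `|z| = 1 ->
  (reflect_poly m p).[z] = z ^+ m * (p.[z])^*.
Proof.
move=> sp z1; have z0 : z != 0 by rewrite -normr_eq0 z1 oner_neq0.
by rewrite horner_reflect // invC_norm norm_conjC z1 expr1n invr1 mul1r conjCK.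
Qed.

(** On the circle [1 - a^* * z = z * (z - a)^*], factor by factor, and two polynomials that agree on
    the circle are equal. *)
Lemma reflect_prod (s : seq C) c :
  reflect_poly (size s) (c *: \prod_(a <- s) ('X - a%:P)) =
  c^* *: \prod_(a <- s) (1 - a^* *: 'X).
Proof.
apply/eqP; rewrite -subr_eq0; apply/eqP.
apply: (@circle_poly_eq0 _ 1 (oner_neq0 _)) => z z1 _.
rewrite hornerD hornerN horner_reflect_circle ?(leq_trans (size_scale_leq _ _))
  ?size_prod_XsubC //.
rewrite !hornerZ rmorphM mulrCA -mulrBr !horner_prod.
apply/eqP; rewrite mulf_eq0; apply/orP; right; rewrite subr_eq0; apply/eqP.
elim: s => [|a s IH]; first by rewrite !big_nil expr0 rmorph1 mulr1.
rewrite !big_cons /= -IH exprS rmorphM /= !(hornerE, rmorphB) /=.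
have zz : z * z^* = 1 by rewrite -normCK z1 expr1n.
rewrite -zz; ring.
Qed.

Lemma disk_factor_norm a z :
  `|1 - a^* * z| ^+ 2 - `|z - a| ^+ 2 = (1 - `|z| ^+ 2) * (1 - `|a| ^+ 2).
Proof.
rewrite !normCK !rmorphB rmorph1 rmorphM /= conjCK; ring.
Qed.

Lemma disk_factor_lt a z : `|a| < 1 -> `|z| < 1 -> `|z - a| < `|1 - a^* * z|.
Proof.
move=> a1 z1; rewrite -(@ltr_pXn2r _ 2) ?nnegrE // -subr_gt0 disk_factor_norm.
by rewrite mulr_gt0 // subr_gt0 expr_lt1.
Qed.

Lemma disk_factor_gt a z : `|a| < 1 -> 1 < `|z| -> `|1 - a^* * z| < `|z - a|.
Proof.
move=> a1 z1; rewrite -(@ltr_pXn2r _ 2) ?nnegrE // -subr_lt0 disk_factor_norm.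
by rewrite pmulr_llt0 ?subr_lt0 ?subr_gt0 ?expr_lt1 ?expr_gt1 // ltW.
Qed.

(** Equality of moduli on the circle gives [F * rF = G * rG] for the reciprocals. Both pairs are
    coprime, so [F] is a multiple of [rG]. The bound by [M] makes a zero of [G] in the closed disk a
    zero of [F], which coprimality forbids; hence the roots of [F], reflections of those of [G], lie
    in the open disk. *)
Lemma blaschke_factorization m M d F G : d != 0 -> 0 <= M ->
  coprimep F G -> (size F <= m.+1)%N -> (size G <= m.+1)%N ->
  (F`_m != 0) || (G`_m != 0) ->
  (forall z, `|z| < 1 -> d.[z] != 0 -> `|F.[z]| <= M * `|G.[z]|) ->
  (forall z, `|z| = 1 -> d.[z] != 0 -> `|F.[z]| = `|G.[z]|) ->
  exists (s : seq C) k c, [/\ size s = m, {in s, forall a, `|a| < 1},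
    `|k| = 1 /\ c != 0, F = c *: \prod_(a <- s) ('X - a%:P) &
    G = (k * c) *: \prod_(a <- s) (1 - a^* *: 'X)].
Proof.
move=> d0 M0 FG sF sG lead le_disk eq_circle.
pose rF := reflect_poly m F; pose rG := reflect_poly m G.
have FrF : F * rF = G * rG.
  apply/eqP; rewrite -subr_eq0; apply/eqP.
  apply: (circle_poly_eq0 d0) => z z1 dz.
  rewrite hornerD hornerN !hornerM !horner_reflect_circle //.
  by rewrite mulrCA [X in _ - X]mulrCA -mulrBr -!normCK eq_circle // subrr mulr0.
have Gn0 z : `|z| <= 1 -> G.[z] != 0.
  move=> z1; apply/eqP => Gz.
  have := closed_disk_le M0 d0 le_disk z1; rewrite Gz normr0 mulr0 normr_le0 => Fz.
  by have := coprimep_root FG Fz; rewrite Gz eqxx.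
have rG0 : rG != 0.
  apply: contraNneq (Gn0 0 _) => [rG0|]; last by rewrite normr0.
  have : rG`_m = 0 by rewrite rG0 coef0.
  by rewrite coef_poly ltnSn subnn horner_coef0 => /eqP; rewrite conjC_eq0.
have crFG : coprimep rF rG.
  apply: Pdiv.ClosedField.root_coprimep => z rz; apply/eqP => gz.
  (* A common root of the reciprocals at 0 is a common zero of [F] and [G] at infinity; [lead]
     excludes it, since it makes [m] the true degree of the pair. *)
  have [z0|zn0] := eqVneq z 0.
    move: rz gz; rewrite z0 rootE !horner_coef0 !coef_poly /= subn0 conjC_eq0.
    by move=> /eqP Fm /eqP; rewrite conjC_eq0 => /eqP Gm; rewrite Fm Gm !eqxx in lead.
  move: rz gz; rewrite rootE !horner_reflect // => /eqP.
  move=> /eqP; rewrite mulf_eq0 expf_eq0 (negPf zn0) andbF conjC_eq0 /= => Fz.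
  move=> /eqP; rewrite mulf_eq0 expf_eq0 (negPf zn0) andbF conjC_eq0 /= => Gz.
  by have := coprimep_root FG Fz; rewrite Gz.
have /eqpP [[c1 c2] /= /andP[c10 c20] e] : F %= rG.
  rewrite /eqp -(Gauss_dvdpr _ FG) -FrF dvdp_mulr //=.
  rewrite -(@Gauss_dvdpl _ F rF rG) ?FrF ?dvdp_mull //.
  by rewrite coprimep_sym.
pose k := c1^-1 * c2.
have k0 : k != 0 by rewrite mulf_neq0 ?invr_eq0.
have Fk : F = k *: rG by rewrite -scalerA -e scalerA mulVf // scale1r.
have Gk : G = k *: rF.
  by apply: (mulIf rG0); rewrite -FrF Fk -scalerAl -scalerAl mulrC.
clearbody k; have F0 : F != 0 by rewrite Fk scaler_eq0 negb_or k0.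
have k1 : `|k| = 1.
  have : F = (k * k^*) *: F.
    rewrite [LHS]Fk -scalerA; congr (_ *: _); apply/polyP => j.
    rewrite coefZ coef_poly; case: ltnP => jm; last by rewrite nth_default ?mulr0 //
      (leq_trans sF).
    by rewrite Gk coefZ coef_poly ltnS leq_subr subKn // rmorphM /= conjCK.
  rewrite -[X in X = _ -> _]scale1r => /eqP; rewrite -subr_eq0 -scalerBl scaler_eq0.
  rewrite (negPf F0) orbF subr_eq0 -normCK => /eqP /esym /eqP.
  by rewrite sqrp_eq1 // => /eqP.
have szF : size F = m.+1.
  apply/eqP; rewrite eqn_leq sF ltnNge; apply/negP => /leq_sizeP /(_ m (leqnn _)).
  rewrite Fk coefZ coef_poly ltnSn subnn => /eqP.
  rewrite mulf_eq0 (negPf k0) conjC_eq0 -horner_coef0 /=.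
  by apply/negP/Gn0; rewrite normr0.
have [s Fs] := closed_field_poly_normal F.
set c := lead_coef F in Fs.
have c0 : c != 0 by rewrite lead_coef_eq0.
have szs : size s = m by apply/eqP; rewrite -eqSS -szF Fs size_scale // size_prod_XsubC.
(* Reflection turns the leading constant [c] of [F] into [c^*]; the quotient [c^* / c] restores the
   common factor [c] and is unimodular. *)
exists s, (k * c^* / c), c; split=> //.
- move=> a sa; have : root F a by rewrite Fs rootZ // root_prod_XsubC.
  have [->|a0] := eqVneq a 0; first by rewrite normr0.
  rewrite Fk rootZ // rootE horner_reflect // mulf_eq0 expf_eq0 (negPf a0) andbF /=.
  rewrite conjC_eq0; apply: contraTT; rewrite -real_leNgt ?normr_real ?real1 // => a1.
  by apply: Gn0; rewrite normfV norm_conjC invf_le1 // (lt_le_trans ltr01).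
- by rewrite -mulrA normrM k1 mul1r normf_div norm_conjC divff // normr_eq0.
- by rewrite Gk divfK // -[RHS]scalerA -reflect_prod szs -Fs.
Qed.

Lemma blaschke_prod_lt (s : seq C) z : (0 < size s)%N ->
  {in s, forall a, `|a| < 1} -> `|z| < 1 ->
  `|(\prod_(a <- s) ('X - a%:P)).[z]| < `|(\prod_(a <- s) (1 - a^* *: 'X)).[z]|.
Proof.
move=> s0 sa z1; rewrite !horner_prod !normr_prod big_seq [ltRHS]big_seq.
apply: ltr_prod => [|a /sa a1]; first by case: (s) s0 => //= a t _; rewrite mem_head.
by rewrite normr_ge0 !hornerE disk_factor_lt.
Qed.

Lemma blaschke_prod_gt (s : seq C) z : (0 < size s)%N ->
  {in s, forall a, `|a| < 1} -> 1 < `|z| ->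
  `|(\prod_(a <- s) (1 - a^* *: 'X)).[z]| < `|(\prod_(a <- s) ('X - a%:P)).[z]|.
Proof.
move=> s0 sa z1; rewrite !horner_prod !normr_prod big_seq [ltRHS]big_seq.
apply: ltr_prod => [|a /sa a1]; first by case: (s) s0 => //= a t _; rewrite mem_head.
by rewrite normr_ge0 !hornerE disk_factor_gt.
Qed.

(* On the circle, [z phi'(z) / phi(z)] is the sum of the Poisson kernels
   [(1 - |a|^2) / |z - a|^2], hence positive. *)
Lemma blaschke_wronskian (s : seq C) (A := \prod_(a <- s) ('X - a%:P))
    (B := \prod_(a <- s) (1 - a^* *: 'X)) z :
  {in s, forall a, `|a| < 1} -> `|z| = 1 -> exists h,
    (if nilp s then h == 0 else 0 < h) /\
    z * (A^`().[z] * B.[z] - A.[z] * B^`().[z]) = h * (A.[z] * B.[z]).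
Proof.
rewrite {}/A {}/B => sa z1; elim: s sa => [|a s IH] sa.
  exists 0; split=> //=; rewrite !big_nil.
  by rewrite -[1 : {poly C}]/(1%:P) !derivC !hornerC !mul0r !mulr0 subrr mulr0.
have [|h [h0 eh]] := IH; first by move=> b bs; apply: sa; rewrite inE bs orbT.
have a1 : `|a| < 1 by apply: sa; rewrite mem_head.
have za : z - a != 0 by rewrite subr_eq0; apply: contraTneq a1 => <-; rewrite z1 ltxx.
exists (h + (1 - `|a| ^+ 2) / `|z - a| ^+ 2); split.
  rewrite /= ltr_wpDl //; first by move: h0; case: nilp => [/eqP->//|/ltW].
  by rewrite divr_gt0 ?subr_gt0 ?expr_lt1 // exprn_gt0 // normr_gt0.
rewrite !big_cons !derivM.
set A := (\prod_(a <- s) ('X - a%:P)) in eh *; set B := (\prod_(a <- s) _) in eh *.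
rewrite !derivB !derivZ !derivX !derivC .
rewrite !(hornerM, hornerD, hornerN, hornerZ, hornerX, hornerC).
move: eh; move: A.[z] B.[z] A^`().[z] B^`().[z] => u v u' v' eh.
have zz : z * z^* = 1 by rewrite -normCK z1 expr1n. rewrite [RHS]mulrDl.
have -> : (1 - `|a| ^+ 2) / `|z - a| ^+ 2 * ((z - a) * u * ((1 - a^* * z) * v)) =
   z * (u * v * (1 - a * a^*)).
  have e : 1 - a^* * z = z * (z - a)^* by rewrite rmorphB /= -zz; ring.
  rewrite e !normCK; have n0 : (z - a)^* != 0 by rewrite conjC_eq0.
  by field; rewrite za andbT -rmorphB.
have -> : h * ((z - a) * u * ((1 - a^* * z) * v)) =
  (z - a) * (1 - a^* * z) * (h * (u * v)) by ring.
rewrite -eh; ring.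
Qed.

(** A root of [F - l *: G] satisfies [|A| = |B|], hence lies on the circle. If it were multiple, the
    Wronskian of [A] and [B] would vanish there, against the positivity of [h] in
    [blaschke_wronskian]. *)
Lemma blaschke_level_separable m M d F G (l : C) : (0 < m)%N -> d != 0 ->
  0 <= M -> coprimep F G -> (size F <= m.+1)%N -> (size G <= m.+1)%N ->
  (F`_m != 0) || (G`_m != 0) ->
  (forall z, `|z| < 1 -> d.[z] != 0 -> `|F.[z]| <= M * `|G.[z]|) ->
  (forall z, `|z| = 1 -> d.[z] != 0 -> `|F.[z]| = `|G.[z]|) ->
  `|l| = 1 -> coprimep (F - l *: G) (F - l *: G)^`() /\ size (F - l *: G) = m.+1.
Proof.
move=> m0 d0 M0 FG sF sG lead le_disk eq_circle l1.
have [s [k [c [szs sa [k1 c0] Fs Gs]]]] :=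
  blaschke_factorization d0 M0 FG sF sG lead le_disk eq_circle.
set A := \prod_(a <- s) _ in Fs; set B := \prod_(a <- s) _ in Gs.
have s0 : (0 < size s)%N by rewrite szs.
have kc0 : k * c != 0 by rewrite mulf_neq0 // -normr_eq0 k1 oner_neq0.
have nFG z : `|F.[z]| = `|c| * `|A.[z]| /\ `|G.[z]| = `|c| * `|B.[z]|.
  by rewrite Fs Gs !hornerZ !normrM k1 mul1r.
have c1 : 0 < `|c| by rewrite normr_gt0.
split.
  apply: Pdiv.ClosedField.root_coprimep => z.
  rewrite rootE derivB derivZ !(hornerD, hornerN, hornerZ) subr_eq0 => /eqP Fz.
  rewrite subr_eq0; apply/eqP => F'z.
  have eAB : `|A.[z]| = `|B.[z]|.
    have [eF eG] := nFG z; apply: (mulfI (lt0r_neq0 c1)).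
    by rewrite -eF -eG Fz normrM l1 mul1r.
  have z1 : `|z| = 1.
    apply/eqP; rewrite eq_le !real_leNgt ?normr_real ?real1 //.
    apply/andP; split; apply/negP => z1.
      by have := blaschke_prod_gt s0 sa z1; rewrite eAB ltxx.
    by have := blaschke_prod_lt s0 sa z1; rewrite eAB ltxx.
  have [h [h0 eh]] := blaschke_wronskian sa z1.
  have A0 : A.[z] != 0.
    rewrite -rootE root_prod_XsubC; apply/negP => /sa.
    by rewrite z1 ltxx.
  have B0 : B.[z] != 0 by rewrite -normr_eq0 -eAB normr_eq0.
  move: h0; rewrite ifF; last by rewrite /nilp eqn0Ngt s0.
  move=> /lt0r_neq0 /negP; apply; rewrite -(mulIr_eq0 _ (mulIf (mulf_neq0 A0 B0))).
  rewrite -eh -(mulrI_eq0 _ (mulfI kc0)) -(mulrI_eq0 _ (mulfI c0)).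
  move: Fz F'z; rewrite Fs Gs !derivZ !hornerZ -/A -/B => Fz F'z.
  have -> : c * (k * c * (z * (A^`().[z] * B.[z] - A.[z] * B^`().[z]))) =
    z * ((c * A^`().[z]) * (k * c * B.[z]) - (c * A.[z]) * (k * c * B^`().[z])).
    by ring.
  by rewrite Fz F'z; apply/eqP; ring.
(* The degree does not drop: the coefficients of degree [m] have moduli [|c|] for [F] and
   [|c| * |A(0)|] for [l *: G], and [|A(0)| < 1]. *)
have szle : (size (F - l *: G)%R <= m.+1)%N.
  by rewrite (leq_trans (size_polyD _ _)) //
    geq_max sF size_polyN (leq_trans (size_scale_leq _ _)).
apply/eqP; rewrite eqn_leq szle ltnNge; apply/negP => /leq_sizeP /(_ m (leqnn _)).
rewrite coefB coefZ => /eqP; rewrite subr_eq0 => /eqP.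
have -> : F`_m = c.
  have : A \is monic by rewrite monic_prod_XsubC.
  by move/monicP; rewrite lead_coefE size_prod_XsubC szs Fs coefZ => ->; rewrite mulr1.
have -> : G`_m = k * c * (A.[0])^*.
  have := reflect_prod s 1; rewrite rmorph1 !scale1r szs => e.
  by rewrite Gs coefZ /B -e coef_poly ltnSn subnn horner_coef0.
have z0 : `|0 : C| < 1 by rewrite normr0.
have := blaschke_prod_lt s0 sa z0; rewrite -/A.
have -> : (\prod_(a <- s) (1 - a^* *: 'X)).[0] = 1.
  by rewrite horner_prod big1 // => a _;
    rewrite hornerD hornerN hornerZ hornerX hornerC mulr0 subr0.
rewrite normr1 => A1 /(congr1 Num.norm); rewrite !normrM l1 k1 !mul1r norm_conjC.
by move=> e; move: A1; rewrite -(ltr_pM2l c1) -e mulr1 ltxx.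
Qed.

(** Simple roots turn inclusion of zero sets into divisibility, and the size bound on [p] leaves a
    constant quotient. The cross-multiplied conclusion avoids a constant that would depend on the
    slice. *)
Lemma blaschke_level_proportional m M d F G (l : C) p : d != 0 ->
  0 <= M -> coprimep F G -> (size F <= m.+1)%N -> (size G <= m.+1)%N ->
  (F`_m != 0) || (G`_m != 0) ->
  (forall z, `|z| < 1 -> d.[z] != 0 -> `|F.[z]| <= M * `|G.[z]|) ->
  (forall z, `|z| = 1 -> d.[z] != 0 -> `|F.[z]| = `|G.[z]|) ->
  `|l| = 1 -> (size p <= m.+1)%N ->
  (forall z, root (F - l *: G) z -> root p z) ->
  forall x y, p.[x] * (F - l *: G).[y] = p.[y] * (F - l *: G).[x].
Proof.
move=> d0 M0 FG sF sG lead le_disk eq_circle l1 sp rp x y.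
have [m0|m0] := posnP m.
  subst m; rewrite (size1_polyC sp) (size1_polyC sF) (size1_polyC sG).
  by rewrite !(hornerE, hornerC).
have [sep szH] := blaschke_level_separable m0 d0 M0 FG sF sG lead le_disk eq_circle l1.
set H := F - l *: G in sep szH rp *.
have [t Ht] := closed_field_poly_normal H.
have h0 : lead_coef H != 0 by rewrite lead_coef_eq0 -size_poly_gt0 szH.
have ut : uniq t.
  rewrite -separable_prod_XsubC unlock; move: sep.
  by rewrite Ht derivZ coprimepZl // coprimepZr.
have szt : size t = m.
  by apply/eqP; rewrite -eqSS -szH Ht size_scale // size_prod_XsubC.
have Hp : H %| p.
  rewrite Ht dvdpZl //; apply: uniq_roots_dvdp; last by rewrite uniq_rootsE.
  apply/allP => b bt; apply: rp.
  by rewrite Ht rootZ // root_prod_XsubC.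
have [q pq] := dvdpP _ _ Hp.
have sq : (size q <= 1)%N.
  have [->|q0] := eqVneq q 0; first by rewrite size_poly0.
  move: sp; rewrite pq size_mul //; last by rewrite -lead_coef_eq0.
  by rewrite szH addnS /= -[m.+1]add1n leq_add2r.
by rewrite pq (size1_polyC sq) !hornerM !hornerC; ring.
Qed.

(** The strict maximum principle at the centre: divided by their gcd, [F] and [G] form a Blaschke
    product of degree [m], which is strictly below 1 inside the disk unless [m = 0]. The gcd also
    serves as the exceptional polynomial. *)
Lemma disk_center_lt_or_proportional M F G : 0 <= M -> G.[0] != 0 ->
  (forall z, `|z| < 1 -> `|F.[z]| <= M * `|G.[z]|) ->
  (forall z, `|z| = 1 -> `|F.[z]| = `|G.[z]|) ->
  `|F.[0]| < `|G.[0]| \/ exists l, F = l *: G.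
Proof.
move=> M0 G0 le_disk eq_circle.
have Gn0 : G != 0 by apply: contraNneq G0 => ->; rewrite horner0.
set d := gcdp F G.
have d0 : d != 0 by rewrite gcdp_eq0 (negPf Gn0) andbF.
pose F1 := F %/ d; pose G1 := G %/ d.
have FE : F = F1 * d by rewrite divpK // dvdp_gcdl.
have GE : G = G1 * d by rewrite divpK // dvdp_gcdr.
have cop : coprimep F1 G1 by rewrite coprimep_div_gcd // Gn0 orbT.
have G10 : G1 != 0 by apply: contraNneq Gn0 => e; rewrite GE e mul0r.
have d00 : d.[0] != 0 by apply: contraNneq G0 => e; rewrite GE hornerM e mulr0.
pose m := (maxn (size F1) (size G1)).-1.
have mS : m.+1 = maxn (size F1) (size G1).
  by rewrite prednK // (leq_trans _ (leq_maxr _ _)) // size_poly_gt0.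
have sF : (size F1 <= m.+1)%N by rewrite mS leq_maxl.
have sG : (size G1 <= m.+1)%N by rewrite mS leq_maxr.
have lead : (F1`_m != 0) || (G1`_m != 0).
  have [le|lt] := leqP (size F1) (size G1).
    by rewrite /m (maxn_idPr le) -lead_coefE lead_coef_eq0 G10 orbT.
  rewrite /m (maxn_idPl (ltnW lt)) -lead_coefE lead_coef_eq0 -size_poly_gt0.
  by rewrite (leq_ltn_trans _ lt).
have le1 z : `|z| < 1 -> d.[z] != 0 -> `|F1.[z]| <= M * `|G1.[z]|.
  move=> z1 dz; have := le_disk z z1; rewrite FE GE !hornerM !normrM mulrA.
  by rewrite ler_pM2r // normr_gt0.
have eq1 z : `|z| = 1 -> d.[z] != 0 -> `|F1.[z]| = `|G1.[z]|.
  move=> z1 dz; have := eq_circle z z1; rewrite FE GE !hornerM !normrM.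
  by move/mulIf; apply; rewrite normr_eq0.
have [m0|m0] := posnP m.
  right; move: sF sG; rewrite m0 => /size1_polyC F1c /size1_polyC G1c.
  exists (F1`_0 / G1`_0); rewrite FE GE F1c G1c !coefC /= !mul_polyC scalerA divfK //.
  by apply: contraNneq G10 => e; rewrite G1c e.
have [s [k [c [szs sa [k1 c0] Fs Gs]]]] :=
  blaschke_factorization d0 M0 cop sF sG lead le1 eq1.
left; rewrite FE GE !hornerM Fs Gs !hornerZ !normrM k1 mul1r.
rewrite ltr_pM2r ?normr_gt0 // ltr_pM2l ?normr_gt0 //.
by apply: blaschke_prod_lt; rewrite ?szs ?normr0.
Qed.

End OneVariable.

(** * Common zeros of coprime bivariate polynomials *)

Section CommonZeros.
Variable C : closedFieldType.
Implicit Types (f g p u D : {poly {poly C}}) (a : C).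

Definition coprime_poly2 f g :=
  forall D u v, f = D * u -> g = D * v -> D \is a GRing.unit.

Lemma coprime_poly2_swap f g :
  coprime_poly2 f g -> coprime_poly2 (swapXY f) (swapXY g).
Proof.
move=> cop D u v fE gE; have : swapXY D \is a GRing.unit.
  by apply: (cop _ (swapXY u) (swapXY v)); rewrite -rmorphM /= -?fE -?gE swapXYK.
move=> /unitrP[w [wD Dw]]; apply/unitrP; exists (swapXY w).
by rewrite -[D]swapXYK -!rmorphM wD Dw rmorph1.
Qed.

Lemma map_horner_eval_eq0 p a : map_poly (horner_eval a) p = 0 ->
  exists q, p = ('X - a%:P) *: q.
Proof.
move=> pa; exists (map_poly (fun c => c %/ ('X - a%:P)) p).
apply/polyP => i; rewrite coefZ coef_map_id0 ?div0p // mulrC divpK //.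
rewrite dvdp_XsubCl rootE; apply/eqP.
by move/polyP/(_ i): pa; rewrite coef_map coef0.
Qed.

(** Separates content and primitive part with respect to the inner variable. Over a closed field,
    primitive means that no evaluation of the inner variable kills the polynomial. Only roots of the
    leading coefficient can do so, and dividing by ['X - a%:P] lowers its degree. *)
Lemma linear_content D : D != 0 -> exists e p, D = e *: p /\
  forall a, map_poly (horner_eval a) p != 0.
Proof.
have [n] := ubnP (size (lead_coef D)); elim: n D => // n IH D Dn D0.
have [rs lE] := closed_field_poly_normal (lead_coef D).
have l0 : lead_coef D != 0 by rewrite lead_coef_eq0.
have [/hasP[a _ /eqP /map_horner_eval_eq0[q qE]]|/hasPn h] :=
  boolP (has (fun a => map_poly (horner_eval a) D == 0) rs).
  have q0 : q != 0 by apply: contraNneq D0 => e; rewrite qE e scaler0.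
  have [||e [p [pE h]]] := IH q => //.
    move: Dn; rewrite qE lead_coefZ ltnS; apply: leq_trans.
    by rewrite size_mul ?polyXsubC_eq0 ?lead_coef_eq0 // size_XsubC.
  by exists (('X - a%:P) * e), p; rewrite -scalerA -pE.
exists 1, D; rewrite scale1r; split=> // a.
have [ar|nar] := boolP (a \in rs); first exact: h.
apply: contraNneq nar => /(congr1 (fun q : {poly C} => q`_(size D).-1)).
rewrite coef_map coef0 /= -lead_coefE /horner_eval => /eqP.
rewrite lE hornerZ mulf_eq0 lead_coef_eq0 (negPf l0) /=.
by rewrite -rootE root_prod_XsubC.
Qed.

(** Gauss's lemma, one linear factor of [e] at a time: modulo such a factor [D] stays nonzero in a
    domain, so the factor divides [u]. *)
Lemma gauss_cancel (e : {poly C}) f u D : e != 0 ->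
  (forall a, map_poly (horner_eval a) D != 0) -> e *: f = u * D ->
  exists v, f = v * D.
Proof.
move=> + Dp; have [n] := ubnP (size e); elim: n e f u => // n IH e f u en e0 eE.
have [/size_poly1P[c c0 ec]|/closed_rootP[a]] := boolP (size e == 1%N).
  exists (c^-1%:P *: u); rewrite -scalerAl -eE ec scalerA -polyCM mulVf //.
  by rewrite scale1r.
move/factor_theorem => [e' e'E].
have e'0 : e' != 0 by apply: contraNneq e0 => h; rewrite e'E h mul0r.
have : map_poly (horner_eval a) u * map_poly (horner_eval a) D = 0.
  rewrite -rmorphM -eE; apply/polyP => i; rewrite coef_map coefZ coef0 /=.
  by rewrite /horner_eval hornerM e'E hornerM hornerXsubC subrr mulr0 mul0r.
move/eqP; rewrite mulf_eq0 (negPf (Dp a)) orbF => /eqP.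
move=> /map_horner_eval_eq0 [u' u'E].
apply: (IH e' f u') => //.
  by move: en; rewrite e'E size_mul ?polyXsubC_eq0 // size_XsubC addn2.
have x0 : ('X - a%:P) != 0 :> {poly C} by rewrite polyXsubC_eq0.
apply: (mulfI (_ : ('X - a%:P)%:P != 0)); first by rewrite polyC_eq0.
by rewrite !mul_polyC scalerA mulrC -e'E eE u'E scalerAl.
Qed.

(** [gcdp] over the domain [{poly C}] is a gcd only up to factors in [y]. If it is free of [x], a
    Bezout relation exhibits a nonzero polynomial in [y] alone in the ideal of [f] and [g].
    Otherwise its primitive part is a genuine common factor of positive degree in [x]. *)
Lemma coprime_common_zerosY f g : coprime_poly2 f g -> exists2 d : {poly C},
  d != 0 & forall x y, f.[x, y] = 0 -> g.[x, y] = 0 -> d.[y] = 0.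
Proof.
move=> cop; set D := gcdp f g.
have D0 : D != 0.
  apply/eqP => /eqP; rewrite gcdp_eq0 => /andP[/eqP f0 /eqP g0].
  have := cop 0 0 0; rewrite f0 g0 mulr0 => /(_ erefl erefl).
  by rewrite unitr0.
have [sD|sD] := leqP (size D) 1.
  have [[u v]] := Pdiv.Idomain.Bezoutp f g; rewrite -/D /=.
  move/Pdiv.Idomain.eqpP => [[c1 c2] /= /andP[c10 c20] e].
  have D00 : D`_0 != 0 by apply: contraNneq D0 => h; rewrite (size1_polyC sD) h.
  exists (c2 * D`_0) => [|x y fx gx]; first exact: mulf_neq0.
  have := congr1 (fun p => p.[x, y]) e; rewrite (size1_polyC sD).
  rewrite !(hornerE, hornerZ) fx gx !mulr0 addr0 mulr0 => /esym.
  by rewrite coefC.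
have [e [p [De pp]]] := linear_content D0.
have e0 : e != 0 by apply: contraNneq D0 => h; rewrite De h scale0r.
have sp : (1 < size p)%N by rewrite De size_scale in sD.
have aux h : D %| h -> exists v, h = p * v.
  move=> /Pdiv.WeakIdomain.dvdpP [[c v] /= c0 cE].
  have [w ->] : exists w, h = w * p.
    apply: (gauss_cancel c0 pp (u := e *: v)).
    by rewrite cE De -scalerAr -scalerAl.
  by exists w; rewrite mulrC.
have [u uE] := aux _ (dvdp_gcdl f g); have [v vE] := aux _ (dvdp_gcdr f g).
have := cop _ _ _ uE vE.
by rewrite poly_unitE => /andP[/eqP s1]; rewrite s1 in sp.
Qed.

Lemma coprime_common_zerosX f g : coprime_poly2 f g -> exists2 d : {poly C},
  d != 0 & forall x y, f.[x, y] = 0 -> g.[x, y] = 0 -> d.[x] = 0.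
Proof.
move/coprime_poly2_swap/coprime_common_zerosY => [d d0 h].
by exists d => // x y fx gx; apply: (h y x); rewrite horner2_swapXY.
Qed.

Lemma coef_horner_polyC f a k : (f.[a%:P])`_k = ((swapXY f)`_k).[a].
Proof. by rewrite horner_polyC coef_map. Qed.

Lemma slice_neq0 f : f != 0 -> exists2 d : {poly C}, d != 0 &
  forall x, d.[x] != 0 -> f.[x%:P] != 0.
Proof.
move=> f0; exists (lead_coef (swapXY f)) => [|x].
  by rewrite lead_coef_eq0 swapXY_eq0.
by apply: contraNneq => fx; rewrite lead_coefE -coef_horner_polyC fx coef0.
Qed.

Lemma coprime_no_root_line f g a : coprime_poly2 f g -> f.[a%:P] = 0 -> g.[a%:P] != 0.
Proof.
move=> cop fa; apply/eqP => ga.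
have aux h : h.[a%:P] = 0 -> exists v, h = ('X - a%:P%:P) * v.
  by move=> /eqP; rewrite -rootE => /factor_theorem [v ->]; exists v; rewrite mulrC.
have [u uE] := aux _ fa; have [v vE] := aux _ ga.
by have := cop _ _ _ uE vE; rewrite poly_unitE size_XsubC.
Qed.

Lemma coprime_multiple_const f g a : coprime_poly2 f g ->
  f = a%:P%:P * g -> (size f <= 1)%N /\ (size g <= 1)%N /\
    (sizeY f <= 1)%N /\ (sizeY g <= 1)%N.
Proof.
move=> cop fg; have gu : g \is a GRing.unit.
  by apply: (cop g a%:P%:P 1); rewrite ?mulr1 // mulrC.
have [c gc] : exists c : C, g = c%:P%:P.
  move: gu; rewrite poly_unitE => /andP[/eqP sg].
  rewrite poly_unitE => /andP[/eqP sg0 _]; exists (g`_0)`_0.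
  by rewrite -size1_polyC ?sg0 // -size1_polyC ?sg.
have aux (b : C) : (size (b%:P%:P : {poly {poly C}})
  <= 1)%N /\ (sizeY (b%:P%:P : {poly {poly C}}) <= 1)%N.
  by rewrite sizeYE swapXY_polyC map_polyC /= !size_polyC; split; case: eqP.
rewrite fg gc -!polyCM.
by have [-> ->] := aux (a * c); have [-> ->] := aux c.
Qed.

End CommonZeros.

(** * Slices and analytic disks in the bidisk *)

Section Bidisk.
Variable C : numClosedFieldType.
Implicit Types (f g p r : {poly {poly C}}) (a b x y z M : C).

(** By Vieta, coefficient [k] is [P(0)] times, up to sign, an elementary symmetric function of the
    inverse roots, each of modulus at most [1 / e]; the power of 2 bounds the binomial coefficient.
    This stands in for Hurwitz's theorem: when [P(0)] tends to 0, so do all coefficients. *)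
Lemma coef_le_of_no_root (P : {poly C}) (e : C) k : 0 < e ->
  (forall x, `|x| < e -> P.[x] != 0) ->
  `|P`_k| * e ^+ k <= 2 ^+ (size P) * `|P`_0|.
Proof.
move=> e0 nr; have [s Ps] := closed_field_poly_normal P.
have [->|P0] := eqVneq P 0; first by rewrite !coef0 normr0 mul0r mulr0.
have l0 : lead_coef P != 0 by rewrite lead_coef_eq0.
have sP : (size s <= size P)%N by rewrite Ps size_scale // size_prod_XsubC.
have se a : a \in s -> e <= `|a|.
  move=> sa; rewrite real_leNgt ?normr_real ?gtr0_real //.
  apply/negP => /nr; rewrite Ps hornerZ mulf_eq0 (negPf l0) /=.
  by rewrite -rootE root_prod_XsubC sa.
have : `|(\prod_(a <- s) ('X - a%:P))`_k| * e ^+ k <=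
    2 ^+ size s * `|(\prod_(a <- s) ('X - a%:P))`_0|.
  elim: s se {sP Ps} k => [|a s IH] se k.
    rewrite !big_nil !coef1 /=; case: k => [|k]; first by rewrite !expr0 mulr1 mul1r.
    by rewrite /= normr0 mul0r normr1 mulr1 ler01.
  have [IHs ea] : (forall k, `|(\prod_(a <- s) ('X - a%:P))`_k| * e ^+ k <=
    2 ^+ size s * `|(\prod_(a <- s) ('X - a%:P))`_0|) /\ e <= `|a|.
    split=> [j|]; last by rewrite se // mem_head.
    by apply: IH => b bs; rewrite se // inE bs orbT.
  rewrite !big_cons; set A := \prod_(j <- s) _ in IHs *.
  rewrite !mulrBl !coefB !coefXM !coefCM /= sub0r normrN normrM exprS.
  have A0 : 0 <= 2 ^+ size s * `|A`_0| by rewrite mulr_ge0 ?exprn_ge0.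
  have -> : 2 * 2 ^+ size s * (`|a| * `|A`_0|) =
    `|a| * (2 ^+ size s * `|A`_0|) + `|a| * (2 ^+ size s * `|A`_0|).
    by rewrite -[2]/(1 + 1); ring.
  rewrite (le_trans (ler_wpM2r (exprn_ge0 _ (ltW e0)) (ler_normB _ _))) //.
  rewrite mulrDl lerD //; last by rewrite normrM -mulrA ler_wpM2l.
  case: k => [|k] /=; first by rewrite normr0 mul0r mulr_ge0.
  rewrite exprS mulrCA ler_pM ?mulr_ge0 ?exprn_ge0 ?(ltW e0) //.
move=> h; rewrite Ps !coefZ !normrM -mulrA [leRHS]mulrCA ler_wpM2l //.
by rewrite (le_trans h) // ler_wpM2r // ler_eXn2l ?ltr1n // -Ps.
Qed.

Lemma closed_bidisk_le f g M : 0 <= M -> g != 0 ->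
  (forall x y, `|x| < 1 -> `|y| < 1 -> g.[x, y] != 0 ->
    `|f.[x, y]| <= M * `|g.[x, y]|) ->
  forall x y, `|x| <= 1 -> `|y| <= 1 -> `|f.[x, y]| <= M * `|g.[x, y]|.
Proof.
move=> M0 g0 h x y x1 y1; have [d d0 dg] := slice_neq0 g0.
rewrite -!(horner2_swapXY _ y x); apply: (closed_disk_le M0 d0) x1 => {}x x1 dx.
rewrite !horner2_swapXY; apply: (closed_disk_le M0 (dg _ dx)) y1 => {}y y1.
exact: h.
Qed.

(* If [f] vanished at [(a, b)], then for [x] near [a] the slice [f(x, -)] would
   have roots near [b], while for all but finitely many [x] it has no common
   root with [g(x, -)].  The bound on coefficients makes this quantitative. *)
Lemma bidisk_no_zero f g : coprime_poly2 f g ->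
  (forall x y, `|x| < 1 -> `|y| < 1 -> f.[x, y] = 0 -> g.[x, y] = 0) ->
  forall a b, `|a| < 1 -> `|b| < 1 -> f.[a, b] != 0.
Proof.
move=> cop fg a b a1 b1; apply/eqP => fab.
have [d d0 dfg] := coprime_common_zerosX cop.
have e0 : 0 < 1 - `|b| by rewrite subr_gt0.
pose c k : {poly C} := ((swapXY f) \Po ('X + b%:P%:P))`_k.
have cE x k : (c k).[x] = (f.[x%:P] \Po ('X + b%:P))`_k.
  rewrite /c -[LHS](@coef_map _ _ (horner_eval x)) horner_polyC.
  by rewrite map_comp_poly rmorphD /= map_polyX map_polyC /= /horner_eval hornerC.
have bound k x : `|x| < 1 -> d.[x] != 0 ->
    `|(c k * (1 - `|b|)%:P ^+ k).[x]| <= 2 ^+ sizeY f * `|(c 0%N).[x]|.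
  move=> x1 dx; rewrite hornerM horner_exp hornerC !cE.
  rewrite normrM normrX (gtr0_norm e0).
  rewrite (le_trans (coef_le_of_no_root k e0 _)) // => [y yb|].
    rewrite horner_comp !hornerE; apply: contraNneq dx => fy.
    have y1 : `|y + b| < 1 by rewrite (le_lt_trans (ler_normD _ _)) // -ltrBrDr.
    by apply/eqP; apply: (dfg x (y + b)) => //; apply: fg.
  rewrite ler_wpM2r // ler_eXn2l ?ltr1n // size_comp_poly2 ?size_XaddC //.
  exact: max_size_evalC.
have M0 : 0 <= 2 ^+ sizeY f :> C by rewrite exprn_ge0.
(* The bound extends from generic [x] to [x = a], where the constant coefficient is [f(a, b) = 0];
   so every coefficient of [f(a, b + Y)] vanishes. *)
have ca0 k : (c k).[a] = 0.
  have := closed_disk_le M0 d0 (bound k) (ltW a1).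
  rewrite [(c 0%N).[a]]cE -horner_coef0 horner_comp hornerD hornerX hornerC add0r.
  rewrite fab normr0 mulr0 normr_le0 hornerM horner_exp hornerC mulf_eq0 expf_eq0.
  by rewrite (gt_eqF e0) andbF orbF => /eqP.
have fa : f.[a%:P] = 0.
  have : f.[a%:P] \Po ('X + b%:P) = 0.
    by apply/polyP => k; rewrite -cE ca0 coef0.
  by move/eqP; rewrite comp_poly2_eq0 ?size_XaddC // => /eqP.
have ga := coprime_no_root_line cop fa.
(* Now [g(a, -)] vanishes on the whole disk although it is a nonzero polynomial: the disk estimate
   with [A = 1], [M = 0] and [g(a, -)] as exceptional polynomial yields [1 <= 0]. *)
have h y : `|y| < 1 -> (g.[a%:P]).[y] != 0 -> `|(1 : {poly C}).[y]| <= 0 * `|(0 :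
  {poly C}).[y]|.
  by move=> y1; rewrite fg ?eqxx // fa horner0.
have := @closed_disk_le _ 1 0 _ 0 (lexx 0) ga h 0.
by rewrite !hornerE normr0 ?mul0r => /(_ ler01); rewrite normr1 ?mulr0 ?mul0r ler10.
Qed.

(** Bihomogeneous form of nominal bidegree [(m, n)]. The free target ring lets it produce numbers,
    one-variable polynomials along analytic disks, and the reflection in two variables. *)
Definition homogenize (A : comNzRingType) (phi : C -> A) (m n : nat)
  p (u1 v1 u2 v2 : A) : A :=
  \sum_(j < m.+1) \sum_(k < n.+1)
    phi p`_j`_k * (u1 ^+ j * v1 ^+ (m - j)) * (u2 ^+ k * v2 ^+ (n - k)).

Lemma rmorph_homogenize (A B : comNzRingType) (h : {rmorphism A -> B})
    (phi : C -> A) m n p (u1 v1 u2 v2 : A) :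
  h (homogenize phi m n p u1 v1 u2 v2) =
  homogenize (h \o phi) m n p (h u1) (h v1) (h u2) (h v2).
Proof.
rewrite rmorph_sum; apply: eq_bigr => j _; rewrite rmorph_sum.
by apply: eq_bigr => k _; rewrite !rmorphM !rmorphXn.
Qed.

Lemma eq_homogenize (A : comNzRingType) (phi psi : C -> A) m n p (u1 v1 u2 v2 : A) :
  phi =1 psi -> homogenize phi m n p u1 v1 u2 v2 = homogenize psi m n p u1 v1 u2 v2.
Proof. by move=> e; apply: eq_bigr => j _; apply: eq_bigr => k _; rewrite e. Qed.

Lemma homogenizeE m n p (u1 v1 u2 v2 : C) :
  (size p <= m.+1)%N -> (sizeY p <= n.+1)%N -> v1 != 0 -> v2 != 0 ->
  homogenize id m n p u1 v1 u2 v2 =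
  v1 ^+ m * v2 ^+ n * p.[u1 / v1, u2 / v2].
Proof.
move=> sp sYp v10 v20.
rewrite (horner_coef_wide _ sp) !horner_sum mulr_sumr; apply: eq_bigr => j _.
have sj : (size (p`_j)%R <= n.+1)%N by rewrite (leq_trans (max_size_coefXY _ _)).
rewrite hornerM (horner_coef_wide _ sj) mulr_suml mulr_sumr.
apply: eq_bigr => k _; rewrite -polyC_exp hornerC.
have jm : (j <= m)%N by rewrite -ltnS.
have kn : (k <= n)%N by rewrite -ltnS.
rewrite -[in v1 ^+ m](subnK jm) -[in v2 ^+ n](subnK kn) !exprD !expr_div_n.
have e1 := expf_neq0 j v10; have e2 := expf_neq0 k v20.
move: (v1 ^+ (m - j)) (v2 ^+ (n - k)) (v1 ^+ j) (v2 ^+ k) e1 e2 => a b s t s0 t0.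
by field; rewrite s0.
Qed.

Lemma poly2_nonroot p : p != 0 -> exists x y, p.[x, y] != 0.
Proof.
have inj : injective (fun k : nat => k%:R : C) by move=> k l /eqP; rewrite eqr_nat =>
  /eqP.
move=> p0; have [d d0 dp] := slice_neq0 p0.
have [k /dp pk] := nonroot_of_injective d0 inj.
by have [j pkj] := nonroot_of_injective pk inj; exists k%:R, j%:R.
Qed.

Lemma torus_poly_eq0 p :
  (forall x y, `|x| = 1 -> `|y| = 1 -> p.[x, y] = 0) -> p = 0.
Proof.
move=> h; apply/eqP/negPn/negP => p0; have [d d0 dp] := slice_neq0 p0.
have {}dp x : `|x| = 1 -> d.[x] = 0.
  move=> x1; apply/eqP/negPn/negP => /dp /eqP; apply.
  by apply: (circle_poly_eq0 (oner_neq0 _)) => y y1 _; apply: h.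
have d00 : d = 0 by apply: (circle_poly_eq0 (oner_neq0 _)) => x x1 _; apply: dp.
by rewrite d00 eqxx in d0.
Qed.

Lemma mobius_denominator_neq0 a z : `|a| < 1 -> `|z| <= 1 -> 1 + a^* * z != 0.
Proof.
move=> a1 z1; apply: contraTneq a1 => /eqP; rewrite addr_eq0 => /eqP e.
have : 1 <= `|a| * `|z| by rewrite -(norm_conjC a)
  -normrM -[_ * z]opprK -e normrN normr1.
move=> h; rewrite -real_leNgt ?normr_real ?real1 // (le_trans h) // ler_piMr //.
Qed.

Lemma mobius_norm a z : `|1 + a^* * z| ^+ 2 - `|z + a| ^+ 2 =
  (1 - `|z| ^+ 2) * (1 - `|a| ^+ 2).
Proof. by rewrite !normCK !rmorphD rmorph1 rmorphM /= conjCK; ring. Qed.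

Lemma mobius_norm_lt1 a z : `|a| < 1 -> `|z| < 1 -> `|(z + a) / (1 + a^* * z)| < 1.
Proof.
move=> a1 z1; have := mobius_denominator_neq0 a1 (ltW z1) => n0.
rewrite normf_div ltr_pdivrMr ?normr_gt0 // mul1r.
rewrite -(@ltr_pXn2r _ 2) ?nnegrE // -subr_gt0 mobius_norm.
by rewrite mulr_gt0 // subr_gt0 expr_lt1.
Qed.

Lemma mobius_norm_eq1 a z : `|a| < 1 -> `|z| = 1 -> `|(z + a) / (1 + a^* * z)| = 1.
Proof.
move=> a1 z1; have n0 : 1 + a^* * z != 0 by rewrite mobius_denominator_neq0 ?z1.
rewrite normf_div; apply: (mulIf (_ : `|1 + a^* * z| != 0)); first by rewrite normr_eq0.
rewrite divfK ?normr_eq0 // mul1r; apply/eqP.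
rewrite -(@eqrXn2 _ 2) // eq_sym -subr_eq0 mobius_norm z1 expr1n subrr mul0r //.
Qed.

(* Through [(a, b)] and any point of the torus passes an analytic disk
   [zeta |-> (mobius_a zeta, mobius_b (kappa zeta))]. *)
Lemma bidisk_norm_lt f g m n M : 0 <= M ->
  (size f <= m.+1)%N -> (sizeY f <= n.+1)%N ->
  (size g <= m.+1)%N -> (sizeY g <= n.+1)%N ->
  (forall l, f <> l%:P%:P * g) ->
  (forall x y, `|x| < 1 -> `|y| < 1 -> g.[x, y] != 0) ->
  (forall x y, `|x| <= 1 -> `|y| <= 1 -> `|f.[x, y]| <= M * `|g.[x, y]|) ->
  (forall x y, `|x| = 1 -> `|y| = 1 -> `|f.[x, y]| = `|g.[x, y]|) ->
  forall a b, `|a| < 1 -> `|b| < 1 -> `|f.[a, b]| < `|g.[a, b]|.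
Proof.
move=> M0 sf sYf sg sYg nprop gn0 le_disk eq_torus a b a1 b1.
have [//|nlt] := boolP (`|f.[a, b]| < `|g.[a, b]|); exfalso.
(* The restriction of [p] to the disk of rotation [k], with the Moebius denominators cleared; the
   parameter 0 gives [(a, b)] for every [k]. *)
pose disk (k : C) p := homogenize polyC m n p
  ('X + a%:P) (1 + a^* *: 'X) (k *: 'X + b%:P) (1 + (b^* * k) *: 'X).
have diskE k p z : `|k| = 1 -> `|z| <= 1 -> (size p <= m.+1)%N -> (sizeY p <= n.+1)%N ->
    (disk k p).[z] = (1 + a^* * z) ^+ m * (1 + b^* * (k * z)) ^+ n *
       p.[(z + a) / (1 + a^* * z), (k * z + b) / (1 + b^* * (k * z))].
  move=> k1 z1 sp sYp.
  rewrite -/(horner_eval z _) rmorph_homogenize /=.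
  rewrite (@eq_homogenize _ _ id); last by move=> x; rewrite /= /horner_eval hornerC.
  rewrite /horner_eval !(hornerD, hornerZ, hornerX, hornerC) -(mulrA b^*).
  by rewrite homogenizeE ?mobius_denominator_neq0 // normrM k1 mul1r.
pose l := f.[a, b] / g.[a, b].
have gab := gn0 a b a1 b1.
have disk0 k p : `|k| = 1 -> (size p <= m.+1)%N -> (sizeY p <= n.+1)%N ->
    (disk k p).[0] = p.[a, b].
  move=> k1 sp sYp; rewrite diskE ?normr0 ?ler01 //.
  by rewrite !mulr0 !addr0 !add0r !divr1 !expr1n !mul1r.
(* The ratio is constant on each disk, and the constant is the same for all [k] because the disks
   share their centre [(a, b)]. *)
have prop k : `|k| = 1 -> disk k f = l *: disk k g.
  move=> k1.
  have G0 : (disk k g).[0] != 0 by rewrite disk0.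
  have [|||] := @disk_center_lt_or_proportional _ M (disk k f) (disk k g) M0 G0.
  - move=> z z1; rewrite !diskE ?(ltW z1) //
    !(normrM (_ * _)) [leRHS]mulrCA ler_wpM2l //.
    by apply: le_disk; apply/ltW/mobius_norm_lt1; rewrite // normrM k1 mul1r.
  - move=> z z1; rewrite !diskE ?z1 // !normrM; congr (_ * _).
    by apply: eq_torus; apply: mobius_norm_eq1; rewrite // normrM k1 mul1r.
  - by rewrite !disk0 // (negPf nlt).
  move=> [l' e]; rewrite e; congr (_ *: _).
  have := congr1 (fun p : {poly C} => p.[0]) e.
  by rewrite hornerZ !disk0 // /l => ->; rewrite mulfK.
apply: (nprop l); apply/eqP; rewrite -subr_eq0; apply/eqP.
apply: torus_poly_eq0 => x y x1 y1.
have na1 : `|- a| < 1 by rewrite normrN.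
have nb1 : `|- b| < 1 by rewrite normrN.
(* [z] and [w] are the preimages of [x] and [y] under the two Moebius maps, so the disk of rotation
   [w / z] meets [(x, y)] at parameter [z]. *)
pose z := (x + - a) / (1 + (- a)^* * x).
pose w := (y + - b) / (1 + (- b)^* * y).
have z1 : `|z| = 1 by apply: mobius_norm_eq1.
have w1 : `|w| = 1 by apply: mobius_norm_eq1.
have inv (c t : C) : `|c| < 1 -> `|t| = 1 -> let s := (t + - c) / (1 + (- c)^* * t) in
    (s + c) / (1 + c^* * s) = t.
  move=> c1 t1 s; have nc1 : `|- c| < 1 by rewrite normrN.
  have n0 : 1 + (- c)^* * t != 0 by apply: mobius_denominator_neq0; rewrite ?t1.
  have s1 : `|s| = 1 by apply: mobius_norm_eq1.
  have n1 : 1 + c^* * s != 0 by apply: mobius_denominator_neq0; rewrite ?s1.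
  apply: (mulIf n1); rewrite divfK //; apply: (mulIf n0).
  have e : s * (1 + (- c)^* * t) = t - c by rewrite divfK.
  rewrite mulrDl e [RHS](_ : _ = t * ((1 + (- c)^* * t)
    + c^* * (s * (1 + (- c)^* * t)))).
    by rewrite e rmorphN; ring.
  by ring.
have za : (z + a) / (1 + a^* * z) = x by apply: inv.
have wb : (w + b) / (1 + b^* * w) = y by apply: inv.
clearbody z w; pose k := w / z.
have z0 : z != 0 by rewrite -normr_eq0 z1 oner_neq0.
have k1 : `|k| = 1 by rewrite normf_div z1 w1 divr1.
have kz : k * z = w by rewrite divfK.
have := congr1 (fun p : {poly C} => p.[z]) (prop k k1).
rewrite hornerZ !diskE ?z1 // kz za wb mulrCA => /mulfI e;
  rewrite hornerD hornerN hornerM !hornerC hornerD hornerN hornerM hornerC e ?subrr //.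
by rewrite mulf_neq0 // expf_neq0 // mobius_denominator_neq0 // ?z1 ?w1.
Qed.

(** On the slice at [t] with [|t| = 1], the one-variable result needs coprimality, which holds off
    the roots of [d], and true degree [n], which holds off those of [e]. The conclusion is
    polynomial in [x], so it extends from these [t] to all [x]. *)
Lemma slice_level_proportional f g r n M l : 0 <= M ->
  coprime_poly2 f g -> (sizeY f <= n.+1)%N -> (sizeY g <= n.+1)%N ->
  ((swapXY f)`_n != 0) || ((swapXY g)`_n != 0) ->
  (forall x y, `|x| <= 1 -> `|y| <= 1 -> `|f.[x, y]| <= M * `|g.[x, y]|) ->
  (forall x y, `|x| = 1 -> `|y| = 1 -> `|f.[x, y]| = `|g.[x, y]|) ->
  `|l| = 1 -> (sizeY r <= n.+1)%N ->
  (forall x y, (f - l%:P%:P * g).[x, y] = 0 -> r.[x, y] = 0) ->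
  forall x y z, r.[x, y] * (f - l%:P%:P * g).[x, z] =
                r.[x, z] * (f - l%:P%:P * g).[x, y].
Proof.
move=> M0 cop sYf sYg lead le_disk eq_torus l1 sr fr x y z.
have [d d0 dfg] := coprime_common_zerosX cop.
have [e e0 ele] : exists2 e : {poly C}, e != 0 & forall x, e.[x] != 0 ->
    ((f.[x%:P])`_n != 0) || ((g.[x%:P])`_n != 0).
  case/orP: lead => h; [exists (swapXY f)`_n | exists (swapXY g)`_n] => // t.
  - by rewrite coef_horner_polyC => ->.
  - by rewrite !coef_horner_polyC => ->; rewrite orbT.
set p := f - _ * _ in fr *.
have pE t : p.[t%:P] = f.[t%:P] - l *: g.[t%:P].
  by rewrite hornerD hornerN hornerM hornerC mul_polyC.
pose u t : {poly C} := (swapXY r).[t%:P]; pose v t : {poly C} := (swapXY p).[t%:P].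
apply/eqP; rewrite -subr_eq0 -!(horner2_swapXY r) -!(horner2_swapXY p) -/(u y)
  -/(u z) -/(v y) -/(v z).
rewrite -!hornerM -hornerN -hornerD; apply/eqP.
suff -> : u y * v z - u z * v y = 0 by rewrite horner0.
apply: (circle_poly_eq0 (mulf_neq0 d0 e0)) => t t1.
rewrite hornerM mulf_eq0 negb_or => /andP[dt et].
rewrite hornerD hornerN !hornerM !horner2_swapXY pE; apply/eqP; rewrite subr_eq0;
  apply/eqP.
have t1' : `|t| <= 1 by rewrite t1.
apply: (@blaschke_level_proportional _ n M 1 f.[t%:P] g.[t%:P] l r.[t%:P]) => //.
- exact: oner_neq0.
- apply: Pdiv.ClosedField.root_coprimep => s /eqP fs.
  by apply: contraNneq dt => gs; apply/eqP/(dfg t s).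
- exact: leq_trans (max_size_evalC _ _) sYf.
- exact: leq_trans (max_size_evalC _ _) sYg.
- exact: ele.
- by move=> s s1 _; apply: le_disk => //; apply: ltW.
- by move=> s s1 _; apply: eq_torus.
- exact: leq_trans (max_size_evalC _ _) sr.
- by move=> s; rewrite -pE => /eqP /fr /eqP.
Qed.

(** Writing [p] for the level polynomial, proportionality along each variable moves [r(x, y)] to
    [r(x, y0)] and then to [r(x0, y0)], giving [r = c p] after multiplication by [p(x, y0)]. That
    factor is the nonzero polynomial [w], so it cancels. *)
Lemma level_proportional f g r m n M l : 0 <= M ->
  coprime_poly2 f g -> (size f <= m.+1)%N -> (size g <= m.+1)%N ->
  (sizeY f <= n.+1)%N -> (sizeY g <= n.+1)%N ->
  (f`_m != 0) || (g`_m != 0) ->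
  ((swapXY f)`_n != 0) || ((swapXY g)`_n != 0) ->
  (forall x y, `|x| <= 1 -> `|y| <= 1 -> `|f.[x, y]| <= M * `|g.[x, y]|) ->
  (forall x y, `|x| = 1 -> `|y| = 1 -> `|f.[x, y]| = `|g.[x, y]|) ->
  `|l| = 1 -> (size r <= m.+1)%N -> (sizeY r <= n.+1)%N ->
  f - l%:P%:P * g != 0 ->
  (forall x y, (f - l%:P%:P * g).[x, y] = 0 -> r.[x, y] = 0) ->
  exists c, r = c%:P%:P * (f - l%:P%:P * g).
Proof.
move=> M0 cop sf sg sYf sYg leadX leadY le_disk eq_torus l1 sr sYr p0 fr.
have hY := slice_level_proportional M0 cop sYf sYg leadY le_disk eq_torus l1 sYr fr.
set p := f - _ * _ in p0 fr hY *.
have pS : swapXY p = swapXY f - l%:P%:P * swapXY g.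
  by rewrite /p raddfB [X in _ - X]rmorphM /= swapXY_polyC map_polyC.
have hX x y z : r.[x, y] * p.[z, y] = r.[z, y] * p.[x, y].
  rewrite -!(horner2_swapXY r) -!(horner2_swapXY p) pS.
  apply: (@slice_level_proportional _ _ _ m M l) => //.
  - exact: coprime_poly2_swap.
  - by rewrite sizeYE swapXYK.
  - by rewrite sizeYE swapXYK.
  - by rewrite !swapXYK.
  - by move=> u v u1 v1; rewrite !horner2_swapXY; apply: le_disk.
  - by move=> u v u1 v1; rewrite !horner2_swapXY; apply: eq_torus.
  - by rewrite sizeYE swapXYK.
  - by move=> u v; rewrite -pS !horner2_swapXY; apply: fr.
clearbody p; have [x0 [y0 p00]] := poly2_nonroot p0.
pose c := r.[x0, y0] / p.[x0, y0]; exists c.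
pose w : {poly {poly C}} := map_poly polyC (swapXY p).[y0%:P].
have wE x y : w.[x, y] = p.[x, y0].
  by rewrite /w horner_map hornerC horner2_swapXY.
have w0 : w != 0 by apply: contraNneq p00 => w0; rewrite -(wE x0 0) w0 !horner0.
apply/eqP; rewrite -subr_eq0 -(mulIr_eq0 _ (mulIf w0)); apply/eqP.
apply: torus_poly_eq0 => x y _ _;
  rewrite !hornerM wE !(hornerD, hornerN, hornerM) !hornerC.
apply: (mulIf p00); rewrite mul0r.
have e1 := hY x y y0; have e2 := hX x y0 x0.
have -> : (r.[x, y] - c * p.[x, y]) * p.[x, y0] * p.[x0, y0] =
  (r.[x, y] * p.[x, y0]) * p.[x0, y0] - c * p.[x0, y0] * (p.[x, y] * p.[x, y0]) by ring.
by rewrite e1 mulrAC e2 divfK //; ring.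
Qed.

End Bidisk.

(** * Null sets of the torus and of the real plane *)

Section NullSets.
Variable R : realType.
Local Notation C := R[i].
Implicit Types (p : poly2 R) (gamma : R -> C).

Definition measurable_complex d (T : measurableType d) (h : T -> C) :=
  measurable_fun setT (fun t => complex.Re (h t) : R) /\
  measurable_fun setT (fun t => complex.Im (h t) : R).

Lemma measurable_complex_cst d (T : measurableType d) (c : C) :
  measurable_complex (fun _ : T => c).
Proof. by split; exact: measurable_cst. Qed.

Lemma measurable_complexD d (T : measurableType d) (h1 h2 : T -> C) :
  measurable_complex h1 -> measurable_complex h2 ->
  measurable_complex (fun t => h1 t + h2 t).
Proof.
move=> [r1 i1] [r2 i2]; split.
  rewrite (_ : (fun t => _) = (fun t => complex.Re (h1 t) + complex.Re (h2 t))).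
    exact: measurable_funD.
  by apply/funext => t; case: (h1 t) (h2 t) => [? ?] [? ?].
rewrite (_ : (fun t => _) = (fun t => complex.Im (h1 t) + complex.Im (h2 t))).
  exact: measurable_funD.
by apply/funext => t; case: (h1 t) (h2 t) => [? ?] [? ?].
Qed.

Lemma measurable_complexM d (T : measurableType d) (h1 h2 : T -> C) :
  measurable_complex h1 -> measurable_complex h2 ->
  measurable_complex (fun t => h1 t * h2 t).
Proof.
move=> [r1 i1] [r2 i2]; split.
  rewrite (_ : (fun t => _) = (fun t =>
    complex.Re (h1 t) * complex.Re (h2 t) - complex.Im (h1 t) * complex.Im (h2 t))).
    by apply: measurable_funB; exact: measurable_funM.
  by apply/funext => t; case: (h1 t) (h2 t) => [? ?] [? ?].
rewrite (_ : (fun t => _) = (fun t =>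
  complex.Re (h1 t) * complex.Im (h2 t) + complex.Im (h1 t) * complex.Re (h2 t))).
  by apply: measurable_funD; exact: measurable_funM.
by apply/funext => t; case: (h1 t) (h2 t) => [? ?] [? ?].
Qed.

Lemma measurable_eval2 d (T : measurableType d) p (h1 h2 : T -> C) :
  measurable_complex h1 -> measurable_complex h2 ->
  measurable_complex (fun t => eval2 p (h1 t, h2 t)).
Proof.
move=> m1 m2; elim/poly_ind: p => [|p q IH].
  rewrite (_ : (fun t => _) = (fun=> 0)); first exact: measurable_complex_cst.
  by apply/funext => t; rewrite /eval2 !horner0.
rewrite (_ : (fun t => _) = (fun t => eval2 p (h1 t, h2 t) * h1 t + q.[h2 t]));
  last first.
  by apply/funext => t; rewrite /eval2 /= hornerMXaddC hornerD hornerM hornerC.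
apply: measurable_complexD; first exact: measurable_complexM.
elim/poly_ind: q => [|q c IHq].
  rewrite (_ : (fun t => _) = (fun=> 0)); first exact: measurable_complex_cst.
  by apply/funext => t; rewrite horner0.
rewrite (_ : (fun t => _) = (fun t => q.[h2 t] * h2 t + c)); last first.
  by apply/funext => t; rewrite hornerMXaddC.
apply: measurable_complexD; last exact: measurable_complex_cst.
exact: measurable_complexM.
Qed.

Lemma countable_root_preimage (I : set R) gamma (q : {poly C}) :
  (forall a, countable (I `&` gamma @^-1` [set a])) -> q != 0 ->
  countable (I `&` [set t | q.[gamma t] = 0]).
Proof.
move=> cI q0; have [rs qE] := closed_field_poly_normal q.
apply: (@sub_countable _ _ _ (\bigcup_(a in [set` rs]) (I `&` gamma @^-1` [set a]))).
  apply: subset_card_le => t [It /eqP].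
  rewrite qE hornerZ mulf_eq0 lead_coef_eq0 (negPf q0) /= -rootE root_prod_XsubC => h.
  by exists (gamma t).
apply: bigcup_countable => //; exact: finite_set_countable.
Qed.

(** By Fubini: off the countably many [x] with [d(gamma x) = 0], the slice polynomial is nonzero and
    the section is countable. The curve [gamma] is kept general to cover both [cis] and the
    inclusion of the reals. *)
Lemma negligible_zero_set (I : set R) gamma p : measurable I ->
  measurable_complex gamma ->
  (forall a, countable (I `&` gamma @^-1` [set a])) -> p != 0 ->
  (@lebesgue2 R).-negligible
    [set t | [/\ I t.1, I t.2 & eval2 p (gamma t.1, gamma t.2) = 0]].
Proof.
move=> mI mg cI p0.
set A := [set t | _].
have mA : measurable A.
  have [mre mim] : measurable_complex (fun t : R * R => eval2 p (gamma t.1, gamma t.2)).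
    apply: measurable_eval2; split.
    - exact: (measurableT_comp mg.1 measurable_fst).
    - exact: (measurableT_comp mg.2 measurable_fst).
    - exact: (measurableT_comp mg.1 measurable_snd).
    - exact: (measurableT_comp mg.2 measurable_snd).
  rewrite (_ : A = (I `*` I) `&`
     ((setT `&` (fun t : R * R =>
       complex.Re (eval2 p (gamma t.1, gamma t.2))) @^-1` [set 0]) `&`
      (setT `&` (fun t : R * R =>
        complex.Im (eval2 p (gamma t.1, gamma t.2))) @^-1` [set 0]))).
    apply: measurableI; first exact: measurableX.
    by apply: measurableI; [apply: mre | apply: mim] => //; exact: measurable_set1.
  apply/seteqP; split => [t [I1 I2 /= e]|t [[I1 I2] [[_ /= re] [_ /= im]]]].
    by split=> //; split; split=> //=; rewrite e.
  by split=> //; apply/eqP; rewrite eq_complex re im !eqxx.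
apply/negligibleP => //.
have [d d0 dp] := slice_neq0 p0.
have null_line : (@lebesgue_measure R).-negligible (I `&` [set t | d.[gamma t] = 0]).
  have cN := countable_root_preimage cI d0.
  exists (I `&` [set t | d.[gamma t] = 0]); split=> //.
    exact: countable_measurable.
  exact: countable_lebesgue_measure0.
transitivity (\int[@lebesgue_measure R]_(x in setT) (cst 0%E x))%E; last first.
  exact: integral0.
apply: ae_eq_integral => //; first exact: measurable_fun_xsection.
apply: negligibleS null_line => x nx; apply: contrapT => nI; apply: nx => _ /=.
apply: countable_lebesgue_measure0.
have [Ix|nIx] := pselect (I x); last first.
  rewrite (_ : xsection A x = set0) //; apply/seteqP; split => // y.
  by rewrite /xsection /= inE => -[].
have /dp qx : d.[gamma x] != 0 by apply/eqP => dx; apply: nI.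
apply: sub_countable (countable_root_preimage cI qx).
by apply: subset_card_le => y; rewrite /xsection /= inE => -[].
Qed.

Lemma cis_countable (a : C) :
  countable (`[0, 2 * pi[%classic `&` @cis R @^-1` [set a]).
Proof.
pose s := acos (complex.Re a).
apply: (@sub_countable _ _ _ [set` [:: s; 2 * pi - s]]); last first.
  exact: finite_set_countable.
apply: subset_card_le => t [/=]; rewrite in_itv /= => /andP[t0 t2] e.
have ct : cos t = complex.Re a by rewrite -e.
rewrite !inE; have [tpi|tpi] := leP t pi.
  by rewrite /s -ct cosK ?eqxx // in_itv /= t0.
have e2 : cos (2 * pi - t) = cos t.
  by rewrite mulr_natl cosB cos2pi sin2pi mul1r mul0r addr0.
rewrite /s -ct -e2 cosK ?subKr ?opprB ?eqxx ?orbT // in_itv /=.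
by rewrite subr_ge0 (ltW t2) /= lerBlDr mulr_natl mulr2n lerD2l ltW.
Qed.

Lemma measurable_cis : measurable_complex (@cis R).
Proof.
by split; apply: continuous_measurable_fun;
  [exact: continuous_cos | exact: continuous_sin].
Qed.

Lemma measurable_real_complex : measurable_complex (fun x : R => x%:C%C).
Proof. by split; [exact: measurable_id | exact: measurable_cst]. Qed.

Lemma real_complex_countable (a : C) :
  countable ([set: R] `&` (fun x : R => x%:C%C) @^-1` [set a]).
Proof.
apply: (@sub_countable _ _ _ [set complex.Re a]); last exact: countable1.
by apply: subset_card_le => t [_ <-].
Qed.

Lemma not_negligible_square (a b : R) : a < b ->
  ~ (@lebesgue2 R).-negligible (`[a, b[%classic `*` `[a, b[%classic).
Proof.
move=> ab nu.
have : @lebesgue2 R (`[a, b[%classic `*` `[a, b[%classic) = 0%E.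
  by apply: measure_negligible nu; exact: measurableX.
rewrite /lebesgue2 product_measure1E //= lebesgue_measure_itv /= lte_fin ab.
rewrite -EFinB -EFinM => -[] /eqP.
by rewrite mulf_eq0 orbb subr_eq0 gt_eqF.
Qed.

Lemma ae_poly_eq0 (I : set R) gamma p (P : R * R -> Prop) (a b : R) :
  measurable I -> measurable_complex gamma ->
  (forall c, countable (I `&` gamma @^-1` [set c])) ->
  a < b -> `[a, b[%classic `<=` I ->
  {ae @lebesgue2 R, forall t, P t} ->
  (forall t, I t.1 -> I t.2 -> P t -> eval2 p (gamma t.1, gamma t.2) = 0) ->
  p = 0.
Proof.
move=> mI mg cI ab abI aeP Pp; apply/eqP/negPn/negP => p0.
apply: (not_negligible_square ab).
apply: negligibleS (negligibleU aeP (negligible_zero_set mI mg cI p0)).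
move=> t [/abI t1 /abI t2].
by have [Pt|nPt] := pselect (P t); [right; split=> //; apply: Pp | left].
Qed.

Lemma poly_neq0_ae (I : set R) gamma p (P : R * R -> Prop) :
  measurable I -> measurable_complex gamma ->
  (forall c, countable (I `&` gamma @^-1` [set c])) -> p != 0 ->
  (forall t, I t.1 -> I t.2 -> eval2 p (gamma t.1, gamma t.2) != 0 -> P t) ->
  {ae @lebesgue2 R, forall t, I t.1 -> I t.2 -> P t}.
Proof.
move=> mI mg cI p0 Pp; apply: negligibleS (negligible_zero_set mI mg cI p0).
move=> t /= nP; apply: contrapT => npt; apply: nP => t1 t2; apply: Pp => //.
by apply/eqP => e; apply: npt.
Qed.

End NullSets.

(** * The Cayley transform and values of rational functions *)

Section Transfer.
Variable R : realType.
Local Notation C := R[i].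
Implicit Types (f g p q r : poly2 R) (z w : C * C).

Lemma eval2D p q z : eval2 (p + q) z = eval2 p z + eval2 q z.
Proof. by rewrite /eval2 !hornerD. Qed.

Lemma eval20 z : eval2 (0 : poly2 R) z = 0.
Proof. by rewrite /eval2 !horner0. Qed.

Lemma eval2N p z : eval2 (- p) z = - eval2 p z.
Proof. by rewrite /eval2 !hornerN. Qed.

Lemma eval2M p q z : eval2 (p * q) z = eval2 p z * eval2 q z.
Proof. by rewrite /eval2 !hornerM. Qed.

Lemma eval2C (c : C) z : eval2 c%:P%:P z = c.
Proof. by rewrite /eval2 !hornerC. Qed.

Lemma differentiable_eval2 p (z : C * C) :
  let K : numFieldType := R[i] in
  differentiable (fun z : K * K => eval2 p z : K) (z : K * K).
Proof.
move=> K.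
have d1 : differentiable (fun z : K * K => z.1) (z : K * K).
  by apply: linear_differentiable => x; exact: cvg_fst.
have d2 : differentiable (fun z : K * K => z.2) (z : K * K).
  by apply: linear_differentiable => x; exact: cvg_snd.
elim/poly_ind: p => [|p q IH].
  rewrite (_ : (fun z => _) = cst 0); first exact: differentiable_cst.
  by apply/funext => t; rewrite /eval2 !horner0.
rewrite (_ : (fun z => _) = (fun z : K * K => eval2 p z : K) * (fun z : K * K => z.1)
    + (fun z : K * K => q.[z.2] : K)); last first.
  by apply/funext => t; rewrite /eval2 /= hornerMXaddC hornerD hornerM hornerC.
apply: differentiableD; first exact: differentiableM.
elim/poly_ind: q => [|q c IHq].
  rewrite (_ : (fun z => _) = cst 0); first exact: differentiable_cst.
  by apply/funext => t; rewrite horner0.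
rewrite (_ : (fun z => _) = (fun z : K * K => q.[z.2] : K) * (fun z : K * K => z.2)
    + cst c); last first.
  by apply/funext => t; rewrite hornerMXaddC.
by apply: differentiableD; [exact: differentiableM | exact: differentiable_cst].
Qed.

Lemma holomorphic_ratio (D : set (C * C)) f g :
  (forall z, D z -> eval2 g z != 0) ->
  holomorphic_on D (fun z => eval2 f z / eval2 g z).
Proof.
move=> g0 K z Dz.
have dg := @differentiable_eval2 g z; have df := @differentiable_eval2 f z.
exact: (differentiableM df (differentiableV dg (g0 _ Dz))).
Qed.

Lemma no_common_factorP f g : no_common_factor f g <-> coprime_poly2 f g.
Proof.
split=> [h d u v fE gE|h d [u fE] [v gE]]; last exact: (h d u v).
by apply: h; [exists u | exists v].
Qed.

(** A value may come from any representation of [phi]; the cross-multiplied form compares it with a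
    fixed one even at points where [g] vanishes. *)
Lemma ratfun_value_cross (phi : ratfun2 R) f g z v : g != 0 ->
  phi = tofrac f / tofrac g -> ratfun_value phi z v ->
  v * eval2 g z = eval2 f z.
Proof.
move=> g0 -> [F [G [e Gz ->]]].
have G0 : G != 0 by apply: contraNneq Gz => ->; rewrite /eval2 !horner0.
have : f * G = F * g.
  apply/eqP; rewrite -tofrac_eq !tofracM -eqr_div ?tofrac_eq0 //.
  exact/eqP.
move=> /(congr1 (fun p => eval2 p z)); rewrite !eval2M => e'.
by rewrite mulrAC -e' mulfK.
Qed.

Lemma ratfun_value_ratio f g z : eval2 g z != 0 ->
  ratfun_value (tofrac f / tofrac g) z (eval2 f z / eval2 g z).
Proof. by move=> gz; exists f, g. Qed.

Lemma Im_gt0E (v : C) : (0 < complex.Im v) = (0 < 'Im v).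
Proof. by rewrite -complexIm (ltcR 0). Qed.

Lemma Im_eq0P (v : C) : complex.Im v = 0 <-> v^* = v.
Proof.
case: v => a b; rewrite -[Num.conj _]/(a +i* - b)%C /=.
split=> [->|[] /eqP]; first by rewrite oppr0.
by rewrite eq_sym -addr_eq0 -mulr2n mulrn_eq0 /= => /eqP.
Qed.

Lemma cayley_norm (w : C) : `|1 - 'i * w| ^+ 2 - `|1 + 'i * w| ^+ 2 = 'Im w *+ 4.
Proof.
rewrite !normCK ImE !(rmorphB, rmorphD) !rmorph1 !rmorphM /= !conjCi.
by field.
Qed.

Lemma cayley_denominator_neq0 (w : C) : 0 <= 'Im w -> 1 - 'i * w != 0.
Proof.
move=> w0; apply/eqP => e; have := cayley_norm w.
have -> : 1 + 'i * w = 2 by move/eqP: e; rewrite subr_eq0 => /eqP <-.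
rewrite e normr0 expr0n /= sub0r => e'.
have : 'Im w *+ 4 < 0 by rewrite -e' oppr_lt0 exprn_gt0 // normr_gt0 pnatr_eq0.
by move=> /(le_lt_trans (mulrn_wge0 4 w0)); rewrite ltxx.
Qed.

Lemma cayley_norm_lt1 (w : C) : 0 < 'Im w -> `|cayley w| < 1.
Proof.
move=> w0; have n0 := cayley_denominator_neq0 (ltW w0).
rewrite /cayley normf_div ltr_pdivrMr ?normr_gt0 // mul1r.
rewrite -(@ltr_pXn2r _ 2) ?nnegrE // -subr_gt0.
by rewrite [X in 0 < X](cayley_norm w) pmulrn_lgt0.
Qed.

Definition cayley_inv (z : C) : C := 'i * (1 - z) / (1 + z).

Lemma cayley_invK (z : C) : 1 + z != 0 -> cayley (cayley_inv z) = z.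
Proof.
move=> z0; rewrite /cayley /cayley_inv -[imag_unit R]/('i : C).
have -> : 'i * ('i * (1 - z) / (1 + z)) = (z - 1) / (1 + z) :> C.
  by rewrite !mulrA -expr2 sqrCi mulN1r opprB.
have h2 : 2 != 0 :> C by rewrite pnatr_eq0.
field; rewrite z0 /= (_ : 1 + z - (z - 1) = 2) ?h2 //.
by rewrite opprB addrACA subrr addr0 -[2]/(1 + 1).
Qed.

Lemma Im_cayley_inv (z : C) : 1 + z != 0 ->
  'Im (cayley_inv z) = (1 - `|z| ^+ 2) / `|1 + z| ^+ 2.
Proof.
move=> z0; have z0' : (1 + z)^* != 0 by rewrite conjC_eq0.
rewrite ImE /cayley_inv !normCK !rmorphM /= conjCi fmorphV /=.
rewrite rmorphB rmorphD rmorph1 /= in z0' *.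
have ii : 'i * 'i = -1 :> C by rewrite -expr2 sqrCi.
have -> : 'i * (- 'i * (1 - z^*) / (1 + z^*) - 'i * (1 - z) / (1 + z)) / 2 =
  - ('i * 'i) * ((1 - z^*) / (1 + z^*) + (1 - z) / (1 + z)) / 2 by ring.
rewrite ii opprK mul1r.
by field; rewrite z0 z0'.
Qed.

Lemma Im_level_quotient (F G : C) : F + G != 0 ->
  'Im (- 'i * ((F - G) / (F + G))) = (`|G| ^+ 2 - `|F| ^+ 2) / `|F + G| ^+ 2.
Proof.
move=> z0; have z0' : (F + G)^* != 0 by rewrite conjC_eq0.
rewrite ImE !normCK !rmorphM /= rmorphN /= conjCi opprK fmorphV /=.
rewrite rmorphB rmorphD /= in z0' *.
have ii : 'i * 'i = -1 :> C by rewrite -expr2 sqrCi.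
have -> : 'i * ('i * ((F^* - G^*) / (F^* + G^*)) - - 'i * ((F - G) / (F + G))) / 2 =
  ('i * 'i) * (((F^* - G^*) / (F^* + G^*)) + ((F - G) / (F + G))) / 2 by ring.
rewrite ii.
by field; rewrite z0 z0'.
Qed.

Lemma Im_eq0E (v : C) : 'Im v = 0 -> complex.Im v = 0.
Proof. by rewrite -complexIm => -[]. Qed.

Lemma norm_cis (t : R) : `|cis t : C| = 1.
Proof. by rewrite normc_def /= cos2Dsin2 sqrtr1. Qed.

(** The two-variable reciprocal [x^m y^n conj (f (1 / conj x, 1 / conj y))]: the substitution
    [u = 1], [v = 'X] or ['Y] reverses the coefficients. *)
Definition reflect_poly2 m n f : poly2 R :=
  homogenize (fun c => (c^*)%:P%:P) m n f 1 'X 1 'Y.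

Lemma reflect_poly2E m n f (x y : C) : (size f <= m.+1)%N -> (sizeY f <= n.+1)%N ->
  `|x| = 1 -> `|y| = 1 ->
  (reflect_poly2 m n f).[x, y] = x ^+ m * y ^+ n * (f.[x, y])^*.
Proof.
move=> sf sYf x1 y1.
have x0 : x != 0 by rewrite -normr_eq0 x1 oner_neq0.
have y0 : y != 0 by rewrite -normr_eq0 y1 oner_neq0.
have inv (t : C) : `|t| = 1 -> 1 / t^* = t.
  by move=> t1; rewrite mul1r invC_norm norm_conjC t1 expr1n invr1 mul1r conjCK.
rewrite /reflect_poly2 -[LHS]/(horner_eval y (horner_eval x%:P _)).
rewrite !rmorph_homogenize !rmorph1 /= /horner_eval !hornerX !hornerC hornerX.
rewrite (@eq_homogenize _ _ _ (Num.conj \o id)); last first.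
  by move=> c; rewrite /= !hornerC.
rewrite -[1](rmorph1 Num.conj) -[in LHS](conjCK x) -[in LHS](conjCK y).
rewrite -rmorph_homogenize homogenizeE ?conjC_eq0 //.
by rewrite !inv // !rmorphM !rmorphXn /= !conjCK.
Qed.

End Transfer.

(** * From inner functions to Pick functions *)

Lemma coef_max_size_neq0 (A : nzRingType) (f g : {poly A}) m : g != 0 ->
  maxn (size f).-1 (size g).-1 = m -> (f`_m != 0) || (g`_m != 0).
Proof.
move=> g0 <-; have lg : lead_coef g != 0 by rewrite lead_coef_eq0.
have [le|lt] := leqP (size f).-1 (size g).-1; first by rewrite -lead_coefE lg orbT.
have f0 : f != 0 by apply: contraTneq lt => ->; rewrite size_poly0.
by rewrite -lead_coefE lead_coef_eq0 f0.
Qed.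

Lemma size_le_max (A : nzRingType) (f g : {poly A}) m :
  maxn (size f).-1 (size g).-1 = m -> (size f <= m.+1)%N /\ (size g <= m.+1)%N.
Proof.
by move=> <-; split; rewrite (leq_trans (leqSpred _)) // ltnS ?leq_maxl ?leq_maxr.
Qed.

Lemma max_size_add (A : nzRingType) (f g : {poly A}) m :
  (size f <= m.+1)%N -> (size g <= m.+1)%N -> (size (f + g)).-1 = m ->
  maxn (size f).-1 (size g).-1 = m.
Proof.
move=> sf sg dm; apply/eqP; rewrite eqn_leq geq_max -!subn1 !leq_subLR !add1n sf sg /=.
have := size_polyD f g; rewrite -dm !leq_max => /orP[h|h]; apply/orP.
  by left; rewrite -!subn1 leq_sub2r.
by right; rewrite -!subn1 leq_sub2r.
Qed.

Section Forward.
Variable R : realType.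
Local Notation C := R[i].
Implicit Types (f g p q r : poly2 R) (z w : C * C).

(** Multiplied by the unimodular [x^m y^n], the equation [|f|^2 = |g|^2] is polynomial on the torus.
    Hence it passes from almost every point to every point, zeros of [g] included. *)
Lemma inner_eq_torus f g m n : lowest_terms (tofrac f / tofrac g) f g ->
  (size f <= m.+1)%N -> (size g <= m.+1)%N ->
  (sizeY f <= n.+1)%N -> (sizeY g <= n.+1)%N ->
  ae_on_torus (fun z => exists2 v, ratfun_value (tofrac f / tofrac g) z v & `|v| = 1) ->
  forall x y, `|x| = 1 -> `|y| = 1 -> `|f.[x, y]| = `|g.[x, y]|.
Proof.
move=> [g0 _ _] sf sg sYf sYg ae x y x1 y1.
have p0 : f * reflect_poly2 m n f - g * reflect_poly2 m n g = 0.
  apply: (@ae_poly_eq0 R `[0, 2 * pi[%classic (@cis R) _ _ 0 (2 * pi)) ae _ => //.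
  - exact: measurable_cis.
  - exact: cis_countable.
  - by rewrite mulr_gt0 // pi_gt0.
  move=> [s t] /= s1 t1 /(_ s1 t1) [v vv v1].
  have e := ratfun_value_cross g0 erefl vv.
  rewrite eval2D eval2N !eval2M.
  rewrite [eval2 (reflect_poly2 _ _ f) _]reflect_poly2E ?norm_cis //.
  rewrite [eval2 (reflect_poly2 _ _ g) _]reflect_poly2E ?norm_cis //.
  rewrite mulrCA [X in _ - X]mulrCA -mulrBr -!normCK.
  by rewrite -[X in `|X| ^+ 2 - _]e normrM v1 mul1r subrr mulr0.
have /eqP := congr1 (fun p => eval2 p (x, y)) p0.
rewrite eval2D eval2N !eval2M eval20.
rewrite [eval2 (reflect_poly2 _ _ f) _]reflect_poly2E //.
rewrite [eval2 (reflect_poly2 _ _ g) _]reflect_poly2E //.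
rewrite mulrCA [X in _ - X]mulrCA -mulrBr -!normCK.
rewrite !mulf_eq0 !expf_eq0 -[x == 0]normr_eq0 -[y == 0]normr_eq0 x1 y1.
rewrite oner_eq0 !andbF /= subr_eq0 => /eqP e.
by apply/eqP; rewrite -(@eqrXn2 _ 2) // e.
Qed.

Lemma inner_le_disk f g : g != 0 -> rational_inner (tofrac f / tofrac g) ->
  exists2 M : C, 0 <= M & forall x y, `|x| <= 1 -> `|y| <= 1 ->
    `|f.[x, y]| <= M * `|g.[x, y]|.
Proof.
move=> g0 [[h [_ hv [M hM]]] _].
have M0 : 0 <= M.
  by apply: le_trans (hM (0, 0) _); rewrite // /bidisk /= normr0.
exists M => //; apply: closed_bidisk_le => // x y x1 y1 gxy.
have zD : bidisk (x, y) by [].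
have := hM _ zD; rewrite (hv _ _ zD (@ratfun_value_ratio _ f g (x, y) gxy)).
by rewrite normf_div ler_pdivrMr // normr_gt0.
Qed.

Lemma pick_of_inner (r q f g : poly2 R) (phi : ratfun2 R) (m n : nat) :
  bideg r = (m, n) -> bideg q = (m, n) -> (m, n) != (0%N, 0%N) ->
  rational_inner phi -> lowest_terms phi f g -> bideg_frac f g = (m, n) ->
  level_set f g 1 = zero_set r -> level_set f g (- 1) = zero_set q ->
  exists2 c : C, c != 0 &
    rational_inner_pick
      (tofrac (c%:P%:P * halfplane_poly m n r) / tofrac (halfplane_poly m n q)).
Proof.
move=> dr dq mn inner [g0 phiE /no_common_factorP cop] [dX dY] Lr Lq.
subst phi.
have [sf sg] := size_le_max dX;
  have [sYf sYg] : (sizeY f <= n.+1)%N /\ (sizeY g <= n.+1)%N.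
  by rewrite !sizeYE; apply: size_le_max; rewrite -!sizeYE.
have [srm sqm sYr sYq] : [/\ (size r <= m.+1)%N, (size q <= m.+1)%N,
    (sizeY r <= n.+1)%N & (sizeY q <= n.+1)%N].
  by move: dr dq => [<- <-] [em en]; rewrite !leqSpred -em -en !leqSpred.
have [M M0 le_disk] := inner_le_disk g0 inner.
have eq_torus : forall x y, `|x| = 1 -> `|y| = 1 -> `|f.[x, y]| = `|g.[x, y]|.
  apply: (@inner_eq_torus f g m n) => //; last exact: inner.2.
  by split=> //; apply/no_common_factorP.
(* Proportional coprime polynomials are constant, against [(m, n) != (0, 0)]. That case is
   exceptional: a unimodular constant other than 1 and -1 has empty level sets, while a constant
   [Phi] cannot be real and have positive imaginary part. *)
have nprop (l : C) : f <> l%:P%:P * g.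
  move=> e; have [s1 [s2 [s3 s4]]] := coprime_multiple_const cop e.
  move: mn; rewrite -dX -dY; move: s1 s2 s3 s4.
  by case: (size f) (size g) (sizeY f) (sizeY g) => [|[|?]] [|[|?]] [|[|?]] [|[|?]].
have gn0 x y : `|x| < 1 -> `|y| < 1 -> g.[x, y] != 0.
  apply: (@bidisk_no_zero _ g f) => [d u v gE fE|a b a1 b1 gab];
    first exact: (cop d v u).
  have := le_disk a b (ltW a1) (ltW b1); rewrite gab normr0 mulr0 normr_le0.
  by move/eqP.
have lt_disk := bidisk_norm_lt M0 sf sYf sg sYg nprop gn0 le_disk eq_torus.
have leadX := coef_max_size_neq0 g0 dX.
have leadY : ((swapXY f)`_n != 0) || ((swapXY g)`_n != 0).
  by apply: coef_max_size_neq0; rewrite ?swapXY_eq0 // -!sizeYE.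
have level (l : C) (t : poly2 R)
  : `|l| = 1 -> (size t <= m.+1)%N -> (sizeY t <= n.+1)%N ->
    level_set f g l = zero_set t -> t != 0 ->
    exists2 a : C, a != 0 & t = a%:P%:P * (f - l%:P%:P * g).
  move=> l1 st sYt Lt t0; have [| |a aE] := level_proportional M0 cop sf sg sYf sYg
    leadX leadY le_disk eq_torus l1 st sYt.
  - by rewrite subr_eq0; apply/eqP/nprop.
  - move=> x y; rewrite -[_.[x, y]]/(eval2 _ (x, y)) eval2D eval2N eval2M eval2C =>
    /eqP; rewrite subr_eq0 => /eqP e.
    by have : level_set f g l (x, y) by []; rewrite Lt.
  exists a => //; apply: contraNneq t0 => a0.
  by rewrite aE a0 !polyC0 mul0r.
have bideg_neq0 (t : poly2 R) : bideg t = (m, n) -> t != 0.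
  move=> dt; apply: contraNneq mn => t0; rewrite -dt t0 /bideg size_poly0.
  by rewrite sizeYE raddf0 size_poly0.
have [a a0 rE] := level 1 r (normr1 _) srm sYr Lr (bideg_neq0 _ dr).
have [b b0 qE] := level (- 1) q (etrans (normrN _) (normr1 _))
  sqm sYq Lq (bideg_neq0 _ dq).
have rz z : eval2 r z = a * (eval2 f z - eval2 g z).
  by rewrite rE eval2M eval2D eval2N eval2M !eval2C mul1r.
have qz z : eval2 q z = b * (eval2 f z + eval2 g z).
  by rewrite qE eval2M eval2D eval2N eval2M !eval2C mulN1r opprK.
(* From [r = a (f - g)] and [q = b (f + g)], this choice makes [c r / q] equal to
   [-i (f - g) / (f + g)]. *)
pose c : C := - 'i * (b / a).
have c0 : c != 0 by rewrite !mulf_neq0 ?oppr_eq0 ?neq0Ci ?invr_eq0.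
exists c => //.
set Phi := tofrac _ / tofrac _.
pose z w := (cayley w.1, cayley w.2).
pose u w := (1 - imag_unit R * w.1) ^+ m * (1 - imag_unit R * w.2) ^+ n.
have u0 w : 0 <= 'Im w.1 -> 0 <= 'Im w.2 -> u w != 0.
  by move=> w1 w2; rewrite mulf_neq0 // expf_neq0 // cayley_denominator_neq0.
have QE w : 0 <= 'Im w.1 -> 0 <= 'Im w.2 ->
    eval2 (halfplane_poly m n q) w = u w * (b * (eval2 f (z w) + eval2 g (z w))).
  by move=> w1 w2; rewrite halfplane_polyE ?cayley_denominator_neq0 // qz.
have PhiE w : 0 <= 'Im w.1 -> 0 <= 'Im w.2 -> eval2 f (z w) + eval2 g (z w) != 0 ->
    ratfun_value Phi w
      (- 'i * ((eval2 f (z w) - eval2 g (z w)) / (eval2 f (z w) + eval2 g (z w)))).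
  move=> w1 w2 fg0; have uw := u0 w w1 w2.
  have Qw : eval2 (halfplane_poly m n q) w != 0 by rewrite QE // mulf_neq0 // mulf_neq0.
  have := ratfun_value_ratio (c%:P%:P * halfplane_poly m n r) Qw.
  congr (ratfun_value _ _ _).
  rewrite eval2M eval2C QE // halfplane_polyE ?cayley_denominator_neq0 //
    rz -/(u w) -/(z w) /c.
  by field; rewrite fg0 a0 b0 uw.
have fg_neq0 x y : `|x| < 1 -> `|y| < 1 -> eval2 f (x, y) + eval2 g (x, y) != 0.
  move=> x1 y1; rewrite addr_eq0; apply: contraTneq (lt_disk _ _ x1 y1).
  by rewrite -/(eval2 f (_, _)) => ->; rewrite normrN ltxx.
split=> [w [w1 w2]|].
  rewrite Im_gt0E in w1; rewrite Im_gt0E in w2.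
  have z1 := cayley_norm_lt1 w1; have z2 := cayley_norm_lt1 w2.
  have fg0 := fg_neq0 _ _ z1 z2.
  eexists; first by apply: PhiE => //; exact: ltW.
  rewrite Im_gt0E Im_level_quotient // divr_gt0 ?exprn_gt0 ?normr_gt0 //.
  by rewrite subr_gt0 ltr_pXn2r ?nnegrE //; exact: lt_disk.
have Q0 : halfplane_poly m n q != 0.
  (* The test point [cayley_inv 0] in both coordinates is sent to the centre of the bidisk, where
     [f + g] does not vanish. *)
  have n10 : 1 + 0 != 0 :> C by rewrite addr0 oner_neq0.
  have im0 : 0 <= 'Im (cayley_inv (0 : C)).
    by rewrite Im_cayley_inv // normr0 addr0 normr1 expr0n expr1n subr0 divr1 ler01.
  have := QE (cayley_inv 0, cayley_inv 0) im0 im0.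
  apply: contra_eqN => /eqP ->; rewrite eval20 eq_sym mulf_neq0 ?u0 // mulf_neq0 //.
  by rewrite /z /= cayley_invK //; apply: fg_neq0; rewrite normr0.
apply: negligibleS (@poly_neq0_ae R setT (fun x => x%:C%C) _ (fun x => exists2 v : C,
  ratfun_value Phi (x.1%:C, x.2%:C)%C v & complex.Im v = 0) measurableT
  (@measurable_real_complex R) (@real_complex_countable R) Q0 _); first by move=>
    t nP h; apply: nP; exact: h.
move=> [s t] _ _ /=.
have rs (x : R) : 'Im (x%:C%C : C) = 0 by rewrite -complexIm.
rewrite QE /= ?rs // => h.
have fg0 : eval2 f (z (s%:C, t%:C)%C) + eval2 g (z (s%:C, t%:C)%C) != 0.
  by move: h; rewrite !mulf_eq0 !negb_or => /and3P[].
eexists; first by apply: PhiE; rewrite //= rs.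
apply: Im_eq0E; rewrite Im_level_quotient //.
rewrite [X in X ^+ 2 - _](_ : _ = `|eval2 f (z (s%:C, t%:C)%C)|) ?subrr ?mul0r //.
by apply/esym/eq_torus; apply: cayley_norm1; rewrite complex_real.
Qed.

End Forward.

(** * From Pick functions to inner functions *)

Section Backward.
Variable R : realType.
Local Notation C := R[i].
Implicit Types (f g p q r : poly2 R) (z w : C * C).

Lemma eval2_conj p (x y : C) : x^* = x -> y^* = y ->
  eval2 (map_poly (map_poly Num.conj) p) (x, y) = (eval2 p (x, y))^*.
Proof.
move=> xr yr; rewrite /eval2 /=.
have -> : x%:P = map_poly Num.conj x%:P by rewrite map_polyC /= xr.
by rewrite horner_map -[in LHS]yr horner_map /= map_polyC /= xr.
Qed.

(** Cayley images of real numbers miss -1, so facts on the real plane reach the torus only off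
    [x = -1] and [y = -1]; this polynomial absorbs the exception. *)
Lemma eval2_1DX_1DY (x y : C) :
  eval2 ((1 + 'X) * (1 + 'Y) : poly2 R) (x, y) = (1 + x) * (1 + y).
Proof. by rewrite eval2M /eval2 !hornerE. Qed.

Lemma mul_1DX_1DY_neq0 : (1 + 'X) * (1 + 'Y) != 0 :> poly2 R.
Proof.
apply/eqP => e; have := eval2_1DX_1DY 0 0.
by rewrite e eval20 !addr0 mulr1 => /esym /eqP; rewrite oner_eq0.
Qed.

(** The degree cannot drop in both the sum and the difference, because they add up to [2 p]. *)
Lemma max_size_add_sub p r m (e : C) :
  (size p).-1 = m -> (size r <= m.+1)%N ->
  maxn (size (p + e%:P%:P * r)%R).-1 (size (p - e%:P%:P * r)%R).-1 = m.
Proof.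
move=> dp sr; have sp : (size p <= m.+1)%N by rewrite -dp leqSpred.
have se : (size (e%:P%:P * r)%R <= m.+1)%N.
  by rewrite mul_polyC (leq_trans (size_scale_leq _ _)).
apply: max_size_add.
- by rewrite (leq_trans (size_polyD _ _)) // geq_max sp.
- by rewrite (leq_trans (size_polyD _ _)) // geq_max sp size_polyN.
rewrite addrACA subrr addr0 -mulr2n -scaler_nat size_scale //.
by rewrite -(rmorph_nat polyC) polyC_eq0 pnatr_eq0.
Qed.

Lemma max_sizeY_add_sub p r n (e : C) :
  (sizeY p).-1 = n -> (sizeY r <= n.+1)%N ->
  maxn (sizeY (p + e%:P%:P * r)%R).-1 (sizeY (p - e%:P%:P * r)%R).-1 = n.
Proof.
have swapZ : swapXY (e%:P%:P * r) = e%:P%:P * swapXY r.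
  by rewrite rmorphM /= swapXY_polyC map_polyC.
by rewrite !sizeYE raddfB raddfD /= swapZ; exact: max_size_add_sub.
Qed.

Lemma circle_cayley (z : C) : `|z| = 1 -> 1 + z != 0 ->
  exists x : R, cayley x%:C%C = z.
Proof.
move=> z1 z0; have : cayley_inv z \is Num.real.
  by apply/Creal_ImP; rewrite Im_cayley_inv // z1 expr1n subrr mul0r.
by move/complex_realP => [x xE]; exists x; rewrite -xE cayley_invK.
Qed.

Lemma inner_of_pick (r q : poly2 R) (m n : nat) (c : C) :
  no_common_factor r q ->
  bideg r = (m, n) -> bideg q = (m, n) -> (m, n) != (0%N, 0%N) -> c != 0 ->
  rational_inner_pick
    (tofrac (c%:P%:P * halfplane_poly m n r) / tofrac (halfplane_poly m n q)) ->
  exists (phi : ratfun2 R) (f g : poly2 R),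
    [/\ rational_inner phi, lowest_terms phi f g, bideg_frac f g = (m, n),
        level_set f g 1 = zero_set r & level_set f g (- 1) = zero_set q].
Proof.
move=> /no_common_factorP cop dr dq mn c0 [pick real_ae].
set Phi := tofrac _ / tofrac _ in pick real_ae.
have [srm sqm sYr sYq] : [/\ (size r <= m.+1)%N, (size q <= m.+1)%N,
    (sizeY r <= n.+1)%N & (sizeY q <= n.+1)%N].
  by move: dr dq => [<- <-] [em en]; rewrite !leqSpred -em -en !leqSpred.
have q0 : q != 0.
  apply: contraNneq mn => t0; rewrite -dq t0 /bideg size_poly0.
  by rewrite sizeYE raddf0 size_poly0.
pose z w := (cayley w.1, cayley w.2).
pose u w := (1 - imag_unit R * w.1) ^+ m * (1 - imag_unit R * w.2) ^+ n.
have u0 w : 0 <= 'Im w.1 -> 0 <= 'Im w.2 -> u w != 0.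
  by move=> w1 w2; rewrite mulf_neq0 // expf_neq0 // cayley_denominator_neq0.
have QE w : 0 <= 'Im w.1 -> 0 <= 'Im w.2 ->
    eval2 (halfplane_poly m n q) w = u w * eval2 q (z w).
  by move=> w1 w2; rewrite halfplane_polyE ?cayley_denominator_neq0.
have RE w : 0 <= 'Im w.1 -> 0 <= 'Im w.2 ->
    eval2 (halfplane_poly m n r) w = u w * eval2 r (z w).
  by move=> w1 w2; rewrite halfplane_polyE ?cayley_denominator_neq0.
have Im0 (x : R) : 'Im (x%:C%C : C) = 0 by rewrite -complexIm.
have conjR (x : R) : (x%:C%C : C)^* = x%:C%C by apply/Im_eq0P.
have torusP p : (forall x y : R, eval2 p (z (x%:C, y%:C)%C) = 0) -> p = 0.
  move=> h; pose p' := p * ((1 + 'X) * (1 + 'Y)).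
  have : p' = 0.
    apply: torus_poly_eq0 => x y x1 y1.
    rewrite -[_.[x, y]]/(eval2 _ (x, y)) eval2M eval2_1DX_1DY.
    have [->|nx] := eqVneq (1 + x) 0; first by rewrite mul0r mulr0.
    have [->|ny] := eqVneq (1 + y) 0; first by rewrite !mulr0.
    have [s sx] := circle_cayley x1 nx; have [t ty] := circle_cayley y1 ny.
    by have := h s t; rewrite /z /= sx ty => ->; rewrite mul0r.
  by move/eqP; rewrite mulf_eq0 (negPf mul_1DX_1DY_neq0) orbF => /eqP.
have Q0 : halfplane_poly m n q != 0.
  apply: contra_neq q0 => Q0; apply: torusP => x y; have := QE (x%:C, y%:C)%C.
  rewrite /= !Im0 lexx Q0 eval20 => /(_ isT isT) /esym /eqP.
  by rewrite mulf_eq0 (negPf (u0 _ _ _)) ?Im0 // => /eqP.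
have cross w v : 0 <= 'Im w.1 -> 0 <= 'Im w.2 -> ratfun_value Phi w v ->
    v * eval2 q (z w) = c * eval2 r (z w).
  move=> w1 w2 /(ratfun_value_cross Q0 erefl).
  rewrite eval2M eval2C QE // RE // mulrCA [RHS]mulrCA.
  exact: mulfI (u0 _ w1 w2) _ _.
have disk_value x y : `|x| < 1 -> `|y| < 1 ->
    exists2 v : C, 0 < 'Im v & v * eval2 q (x, y) = c * eval2 r (x, y).
  move=> x1 y1.
  have inv (t : C) : `|t| < 1 -> 0 < 'Im (cayley_inv t) /\ cayley (cayley_inv t) = t.
    move=> t1; have nt : 1 + t != 0.
      by rewrite addrC addr_eq0; apply: contraTneq t1 => ->; rewrite normrN normr1 ltxx.
    rewrite Im_cayley_inv // cayley_invK // divr_gt0 ?exprn_gt0 ?normr_gt0 //.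
    by rewrite subr_gt0 expr_lt1.
  have [wx wxE] := inv x x1; have [wy wyE] := inv y y1.
  have [|v vv v0] := pick (cayley_inv x, cayley_inv y).
    by split; rewrite Im_gt0E.
  exists v; first by rewrite -Im_gt0E.
  have := cross (cayley_inv x, cayley_inv y) v (ltW wx) (ltW wy) vv.
  by rewrite {1 2}/z /= wxE wyE.
have q_neq0 x y : `|x| < 1 -> `|y| < 1 -> eval2 q (x, y) != 0.
  apply: (@bidisk_no_zero _ q r) => [d s t qE rE|a b a1 b1 qab].
    exact: (cop d t s).
  have [v _] := disk_value a b a1 b1; rewrite [eval2 q _]qab mulr0 => /esym/eqP.
  by rewrite mulf_eq0 (negPf c0) => /eqP.
(* With [v = c r / q], the pair below is [f = (1 + i v) q] and [g = (1 - i v) q], so [f / g] is the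
   Cayley transform of [v]. *)
pose e : C := 'i * c.
have e0 : e != 0 by rewrite mulf_neq0 // neq0Ci.
pose f := q + e%:P%:P * r; pose g := q - e%:P%:P * r.
have fE t : eval2 f t = eval2 q t + e * eval2 r t by rewrite eval2D eval2M eval2C.
have gE t : eval2 g t = eval2 q t - e * eval2 r t.
  by rewrite eval2D eval2N eval2M eval2C.
have disk_fg x y : `|x| < 1 -> `|y| < 1 ->
    eval2 g (x, y) != 0 /\ `|eval2 f (x, y)| <= 1 * `|eval2 g (x, y)|.
  move=> x1 y1; have [v v0 vq] := disk_value x y x1 y1.
  have -> : eval2 f (x, y) = (1 + 'i * v) * eval2 q (x, y).
    by rewrite fE /e -mulrA -vq; ring.
  have -> : eval2 g (x, y) = (1 - 'i * v) * eval2 q (x, y).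
    by rewrite gE /e -mulrA -vq; ring.
  have nv := cayley_denominator_neq0 (ltW v0).
  split; first by rewrite mulf_neq0 // q_neq0.
  rewrite mul1r !normrM ler_wpM2r //.
  have := cayley_norm_lt1 v0; rewrite /cayley normf_div ltr_pdivrMr ?normr_gt0 // mul1r.
  exact: ltW.
have g0 : g != 0.
  have n0 : `|0 : C| < 1 by rewrite normr0.
  by apply/eqP => g0; have [] := disk_fg 0 0 n0 n0; rewrite g0 eval20 eqxx.
have two0 : 2 != 0 :> C by rewrite pnatr_eq0.
exists (tofrac f / tofrac g), f, g; split.
- split.
    exists (fun t => eval2 f t / eval2 g t); split.
    + by apply: holomorphic_ratio => -[x y] [/= x1 y1]; case: (disk_fg x y x1 y1).
    + move=> [x y] v [/= x1 y1] /(ratfun_value_cross g0 erefl) <-.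
      by rewrite mulfK //; case: (disk_fg x y x1 y1).
    + exists 1 => -[x y] [/= x1 y1]; have [gxy le] := disk_fg x y x1 y1.
      by rewrite normf_div ler_pdivrMr // normr_gt0.
  pose pc p := map_poly (map_poly Num.conj) p : poly2 R.
  (* At real points [N] is [c R conj(Q)] minus its conjugate: reality of [c R / Q], cleared of
     denominators, becomes a polynomial identity once coefficients are conjugated by [pc]. *)
  pose N : poly2 R := c%:P%:P * halfplane_poly m n r * pc (halfplane_poly m n q)
    - (c^*)%:P%:P * pc (halfplane_poly m n r) * halfplane_poly m n q.
  have NE (x y : R) : eval2 N (x%:C, y%:C)%C =
      let w := (x%:C, y%:C)%C in c * eval2 (halfplane_poly m n r) w *
        (eval2 (halfplane_poly m n q) w)^* -
      (c * eval2 (halfplane_poly m n r) w * (eval2 (halfplane_poly m n q) w)^*)^*.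
    rewrite eval2D eval2N !eval2M !eval2C !eval2_conj ?conjR //=.
    by rewrite !rmorphM /= conjCK.
  have N0 : N = 0.
    apply: (@ae_poly_eq0 R setT (fun x => x%:C%C) _ _ 0 1) real_ae _ => //.
    - exact: measurable_real_complex.
    - exact: real_complex_countable.
    move=> [x y] _ _ /= [v vv /Im_eq0P vr]; rewrite NE /=.
    have := ratfun_value_cross Q0 erefl vv; rewrite eval2M eval2C => <-.
    by rewrite !rmorphM /= vr conjCK; ring.
  have real_torus (x y : R) : let t := z (x%:C, y%:C)%C in
      (c * eval2 r t * (eval2 q t)^*)^* = c * eval2 r t * (eval2 q t)^*.
    move=> t; have := NE x y; rewrite N0 eval20 /=; set w := (_, _).
    have w1 : 0 <= 'Im w.1 by rewrite Im0.
    have w2 : 0 <= 'Im w.2 by rewrite Im0.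
    rewrite QE // RE // -/t => /esym /eqP.
    rewrite subr_eq0 => /eqP e1.
    have un : u w * (u w)^* != 0 by rewrite mulf_neq0 ?conjC_eq0 //; exact: u0.
    apply: (mulfI un); move: (u w) (eval2 r t) (eval2 q t) un e1 => U A B un.
    rewrite !rmorphM /= !conjCK => e1.
    transitivity (c^* * (U^* * A^*) * (U * B)); first by ring.
    by rewrite -e1; ring.
  pose p := g * ((1 + 'X) * (1 + 'Y)) : poly2 R.
  have p0 : p != 0 by rewrite mulf_neq0 // mul_1DX_1DY_neq0.
  apply: negligibleS (@poly_neq0_ae R `[0, 2 * pi[%classic (@cis R) p
    (fun t => exists2 v : C, ratfun_value (tofrac f / tofrac g) (cis t.1, cis t.2)
      v & `|v| = 1)
    _ (@measurable_cis R) (@cis_countable R) p0 _) => [t nP h||].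
  + by apply: nP => t1 t2; apply: h.
  + exact: measurable_itv.
  move=> [s t] _ _ /=; rewrite eval2M eval2_1DX_1DY !mulf_eq0 !negb_or.
  case/and3P=> gst nx ny.
  exists (eval2 f (cis s, cis t) / eval2 g (cis s, cis t));
    first exact: ratfun_value_ratio.
  have [x xs] := circle_cayley (norm_cis s) nx;
    have [y yt] := circle_cayley (norm_cis t) ny.
  have := real_torus x y; rewrite /z /= xs yt => re.
  rewrite normf_div; apply: (mulIf (_ : `|eval2 g (cis s, cis t)| != 0)).
    by rewrite normr_eq0.
  rewrite divfK ?normr_eq0 // mul1r; apply/eqP; rewrite -(@eqrXn2 _ 2) //; apply/eqP.
  rewrite !normCK fE gE /e.
  move: re; set A := eval2 q _; set B := eval2 r _.
  rewrite !(rmorphD, rmorphN, rmorphM) /= conjCi conjCK => re.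
  apply/eqP; rewrite -subr_eq0; apply/eqP.
  (* This is [|f|^2 - |g|^2], which vanishes because [c r conj(q)] is real at this point of the
     torus. *)
  transitivity ('i * (c * B * A^* - c^* * B^* * A) *+ 2); first by ring.
  by rewrite re subrr mulr0 mul0rn.
- split=> //; apply/no_common_factorP => d s t fd gd.
  have mulK (a b : C) p : a * b = 1 -> a%:P%:P * (b%:P%:P * p) = p.
    by move=> ab; rewrite mulrA -!polyCM ab mul1r.
  (* A common factor of [f] and [g] divides [f - g = 2 e r] and [f + g = 2 q], hence both [r] and
     [q]. *)
  apply: (cop d ((2 * e)^-1%:P%:P * (s - t)) (2^-1%:P%:P * (s + t))).
    rewrite mulrCA mulrBr -fd -gd.
    have -> : f - g = (2 * e)%:P%:P * r by rewrite /f /g !polyCM; ring.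
    by rewrite mulK // mulVf // mulf_neq0.
  rewrite mulrCA mulrDr -fd -gd.
  have -> : f + g = 2%:P%:P * q by rewrite /f /g; ring.
  by rewrite mulK // mulVf.
- rewrite /bideg_frac /=; case: dq => dqX dqY; congr (_, _).
    exact: max_size_add_sub.
  exact: max_sizeY_add_sub.
- apply/seteqP; split => t; rewrite /level_set /zero_set /= fE gE mul1r.
    move=> h; apply/eqP; have : 2 * (e * eval2 r t) == 0.
      rewrite (_ : _ * _ = (eval2 q t + e * eval2 r t) - (eval2 q t - e * eval2 r t)).
        by rewrite h subrr.
      by ring.
    by rewrite mulf_eq0 (negPf two0) mulf_eq0 (negPf e0).
  by move=> ->; rewrite mulr0 addr0 subr0.
apply/seteqP; split => t; rewrite /level_set /zero_set /= fE gE mulN1r opprB.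
  move=> h; apply/eqP; have : 2 * eval2 q t == 0.
    rewrite (_ : _ * _ = (eval2 q t + e * eval2 r t) - (e * eval2 r t - eval2 q t)).
      by rewrite h subrr.
    by ring.
  by rewrite mulf_eq0 (negPf two0).
by move=> ->; rewrite add0r subr0.
Qed.

End Backward.

Theorem lemma6p4 (R : realType) (r q : poly2 R) (m n : nat) :
  no_common_factor r q ->
  bideg r = (m, n) -> bideg q = (m, n) ->
  (m, n) != (0%N, 0%N) ->
  (exists (phi : ratfun2 R) (f g : poly2 R),
    [/\ rational_inner phi,
        lowest_terms phi f g,
        bideg_frac f g = (m, n),
        level_set f g 1 = zero_set r &
        level_set f g (- 1) = zero_set q]) <->
  (exists2 c : R[i], c != 0 &
    rational_inner_pick
      (tofrac (c%:P%:P * halfplane_poly m n r)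
       / tofrac (halfplane_poly m n q))).
Proof.
move=> rq dr dq mn; split=> [[phi [f [g [inner low dfg Lr Lq]]]]|[c c0 pick]].
  exact: pick_of_inner dr dq mn inner low dfg Lr Lq.
exact: inner_of_pick rq dr dq mn c0 pick.
Qed.
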